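(* Fix $\lambda>0$, $c>0$. For each $t>0$ let $T^+=(T^+(s))_{s\in[0,t]}$ be a telegraph meander on $[0,t]$ and let $q_{\lambda,c}(\cdot,t)$ be the density of the absolutely continuous component of the law of $T^+(t)$. Then $u(x,t)=q_{\lambda,c}(x,t)$ satisfies, for $t>0$ and $0<x<ct$, $$\frac{\partial^2u}{\partial t^2}-c^2\frac{\partial^2u}{\partial x^2}+2\lambda\frac{\partial u}{\partial t}-\frac{2a(t)}{t}\frac{\partial u}{\partial t}=\Big(\frac{\lambda}{t}-\frac{2a(t)}{t^2}\Big)u,$$ where $$a(t)=\frac{I_1(\lambda t)}{I_0(\lambda t)+I_1(\lambda t)}.$$
   Context: Let $N$ be a homogeneous Poisson process of rate $\lambda>0$, and let $V(0)$ be independent of $N$ and uniformly distributed on $\{-c,c\}$, $c>0$. Set $V(s)=V(0)(-1)^{N(s)}$ and $T(s)=\int_0^sV(u)\,du$ (telegraph process). For $t>0$, the telegraph meander $T^+$ on $[0,t]$ is the random continuous function on $[0,t]$ whose law is that of $(T(s))_{0\le s\le t}$ conditioned on $\{\min_{0\le s\le t}T(s)\ge0\}$. In particular the law of $T^+(t)$ is the conditional law of $T(t)$ given $\min_{0\le s\le t}T(s)\ge0$; it is supported in $[0,ct]$. The density $q_{\lambda,c}(\cdot,t)$ of its absolutely continuous component is taken to be the version continuous on $[0,ct)$. $I_\nu(x)=\sum_{k\ge0}(x/2)^{2k+\nu}\frac{1}{k!\,\Gamma(\nu+k+1)}$ is the modified Bessel function of the first kind. *)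

(* Defs.v *)
From HB Require Import structures.
From mathcomp Require Import all_boot all_order all_algebra.
From mathcomp Require Import all_classical all_reals all_analysis.

Set Implicit Arguments.
Unset Strict Implicit.
Unset Printing Implicit Defensive.

Import Order.TTheory GRing.Theory Num.Theory.
Import numFieldNormedType.Exports.

Local Open Scope classical_set_scope.
Local Open Scope ring_scope.

Definition Gamma (R : realType) (z : R) : R :=
  Rintegral lebesgue_measure `]0, +oo[%classic
    (fun x : R => x `^ (z - 1) * expR (- x)).

Definition besselI (R : realType) (nu x : R) : R :=
  limn (series (fun k : nat =>
    (x / 2) `^ ((2 * k)%:R + nu) / (k`!%:R * Gamma (nu + k%:R + 1)))).

Definition bessel_ratio (R : realType) (lam t : R) : R :=
  besselI 1 (lam * t) / (besselI 0 (lam * t) + besselI 1 (lam * t)).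

(* Times range over [R], but only [0 <= s] is constrained.  Paths are those of a
   counting process: nondecreasing and right-continuous (for [nat]-valued
   functions, locally constant on the right).  The truncated subtraction is
   harmless since paths are nondecreasing. *)
Record is_poisson_process (R : realType) (d : measure_display)
    (Om : measurableType d) (P : probability Om R) (lam : R)
    (N : R -> {RV P >-> nat}) : Prop := {
  poisson_start : forall w, N 0 w = 0%N ;
  poisson_mono : forall w r s, 0 <= r -> r <= s -> (N r w <= N s w)%N ;
  poisson_rcont : forall w s, 0 <= s -> \forall r \near s^'+, N r w = N s w ;
  poisson_increment : forall (r s : R) (k : nat), 0 <= r -> r < s ->
    P [set w | (N s w - N r w)%N = k] = (poisson_pmf (lam * (s - r)) k)%:E ;
  poisson_indep : forall (n : nat) (s : nat -> R) (B : nat -> set nat),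
    0 <= s 0%N -> (forall i, s i <= s i.+1) ->
    P (\bigcap_(i in `I_n) [set w | B i (N (s i.+1) w - N (s i) w)%N]) =
    (\prod_(i < n) P [set w | B i (N (s i.+1) w - N (s i) w)%N])%E }.

(* The sigma-algebra of events generated by [N s], [0 <= s]. *)
Definition sigma_process (R : realType) (d : measure_display)
    (Om : measurableType d) (P : probability Om R)
    (N : R -> {RV P >-> nat}) : set (set Om) :=
  <<s [set E | exists (s : R) (B : set nat), 0 <= s /\ E = N s @^-1` B] >>.

Record is_telegraph_data (R : realType) (d : measure_display)
    (Om : measurableType d) (P : probability Om R) (lam c : R)
    (N : R -> {RV P >-> nat}) (V0 : {RV P >-> R}) : Prop := {
  telegraph_poisson : is_poisson_process lam N ;
  telegraph_V0_pos : P (V0 @^-1` [set c]) = (2^-1)%:E ;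
  telegraph_V0_neg : P (V0 @^-1` [set - c]) = (2^-1)%:E ;
  telegraph_V0_indep : forall (E : set Om) (B : set R),
    sigma_process N E -> measurable B ->
    P (E `&` V0 @^-1` B) = (P E * P (V0 @^-1` B))%E }.

Definition telegraph_velocity (R : realType) (d : measure_display)
    (Om : measurableType d) (P : probability Om R)
    (N : R -> {RV P >-> nat}) (V0 : {RV P >-> R}) (s : R) (w : Om) : R :=
  V0 w * (-1) ^+ N s w.

Definition telegraph (R : realType) (d : measure_display)
    (Om : measurableType d) (P : probability Om R)
    (N : R -> {RV P >-> nat}) (V0 : {RV P >-> R}) (s : R) (w : Om) : R :=
  Rintegral lebesgue_measure `[0, s]%classic
    (fun u => telegraph_velocity N V0 u w).

(* The event [min_{0 <= s <= t} T(s) >= 0]. *)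
Definition stays_nonneg (R : realType) (Om : Type) (T : R -> Om -> R) (t : R) :
    set Om :=
  [set w | forall s, 0 <= s <= t -> 0 <= T s w].

Definition cond_prob (R : realType) (d : measure_display)
    (Om : measurableType d) (P : probability Om R) (E F : set Om) : R :=
  fine (P (E `&` F)) / fine (P F).

(* The sigma-algebra on paths generated by the evaluations at the times of
   [0, t]; its trace on C([0, t]) is the Borel sigma-algebra. *)
Definition path_events (R : realType) (t : R) : set (set (R -> R)) :=
  <<s [set C | exists (s : R) (B : set R),
        [/\ 0 <= s <= t, measurable B & C = [set f : R -> R | B (f s)]] ] >>.

(* [Tp], restricted to [0, t], is a telegraph meander on [0, t]. *)
Record is_telegraph_meander (R : realType) (d d' : measure_display)
    (Om : measurableType d) (P : probability Om R)
    (N : R -> {RV P >-> nat}) (V0 : {RV P >-> R}) (t : R)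
    (Om' : measurableType d') (Q : probability Om' R)
    (Tp : R -> {RV Q >-> R}) : Prop := {
  meander_continuous : forall w,
    {within `[0, t]%classic, continuous (fun s : R => Tp s w)} ;
  meander_law : forall C : set (R -> R), path_events t C ->
    Q [set w | C (fun s => Tp s w)] =
    (cond_prob P [set w | C (fun s => telegraph N V0 s w)]
                 (stays_nonneg (telegraph N V0) t))%:E }.

(* [q] is a density of the absolutely continuous component in the Lebesgue
   decomposition of [mu]; [nu] is the singular component. *)
Definition is_ac_density (R : realType) (mu : set R -> \bar R) (q : R -> R) :
    Prop :=
  [/\ measurable_fun [set: R] q, (forall x, 0 <= q x) &
    exists nu : {measure set R -> \bar R},
      (exists S : set R, [/\ measurable S, lebesgue_measure S = 0%E
                           & nu (~` S) = 0%E]) /\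
      forall B : set R, measurable B ->
        mu B = (\int[lebesgue_measure]_(x in B) (q x)%:E + nu B)%E].

(* Main.v *)
Require Import Defs.
From HB Require Import structures.
From mathcomp Require Import all_boot all_order all_algebra.
From mathcomp Require Import all_classical all_reals all_analysis.
From mathcomp Require Import measurable_realfun ring lra.
Import Order.TTheory GRing.Theory Num.Theory.
Import numFieldNormedType.Exports.

Local Open Scope classical_set_scope.
Local Open Scope ring_scope.

Set Implicit Arguments.
Unset Strict Implicit.
Unset Printing Implicit Defensive.

(** For [V0 = c] write [S s] for the integral of [(-1) ^ N] over [[0, s]], so that the
telegraph process is [c * S]; for [V0 = - c] the path leaves the half-line at once.
The events [c * S t >= x], [S >= 0] on [[0, t]], [N t = n] have probability
[expR (- lam * t) * K * (c t - x) ^ ceil (n / 2) * (c t + x) ^ floor (n / 2)] with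
[K = (lam / 2 c) ^ n / (ceil (n / 2)! floor (n / 2)!)].  This is proved by induction on
[n]: conditioning on the number of jumps in a short interval shows that along the
lines [x + c t = const] ([n] odd) and [x - c t = const] ([n] even) the probability, multiplied by
[expR (lam * t)], has derivative [lam] times the one for [n - 1].  Summing over [n] gives
the tail of the defective law in terms of the entire functions
[clifford j z = \sum_k z ^ k / (k! (k + j)!)], i.e. modified Bessel functions.
Its [x]-derivative solves the Klein-Gordon equation
[g_tt - c ^ 2 g_xx = lam ^ 2 g], and dividing by the total mass
[I_0 (lam t) + I_1 (lam t)] turns that equation into the stated one. *)

(** * Path integrals of a counting path *)

(** The tail probabilities are not known in advance to be differentiable, so the induction never
    differentiates them. It compares increments over a step [h]: those of the weighted probability
    and those of the explicit polynomial both lie, up to a multiple of [h ^+ 2], between [h * phi r]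
    and [h * phi (r + h)] for the same [phi], and such errors vanish when summed over finer and
    finer subdivisions. Each line also needs an initial value. For odd [n] it is followed back in
    time to the edge [x = c t] of the cone, where the probability is [0]. For even [n] it is
    followed back to the barrier [x = 0]; the value there comes from a separate evolution in time,
    which is possible because lowering the level below [0] does not change the event. Paths without
    a jump give the law an atom at [c t], so the density is identified on the half-open interval
    [[0, c t[] only, from the masses of the rays [[a, +oo[]. *)

Section Path.
Context {R : realType}.
Local Notation mu := (@lebesgue_measure R).
Variable n : R -> nat.
Hypothesis n_mono : forall r s : R, 0 <= r -> r <= s -> (n r <= n s)%N.

Definition signed_time (s : R) : R :=
  Rintegral mu `[0, s]%classic (fun u => (-1) ^+ n u).

Lemma measurable_sign_path (a b : R) : 0 <= a ->
  measurable_fun (`[a, b]%classic : set R) (fun u => (-1) ^+ n u : R).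
Proof.
(* Monotonicity is known only for nonnegative times; clamping the time at [0] gives a function
   monotone on the whole line, hence measurable. *)
move=> a0; pose m (u : R) : R := (n (Num.max u 0))%:R.
have mm : measurable_fun [set: R] m.
  apply: nondecreasing_measurable => // x y xy.
  by rewrite /m ler_nat; apply: n_mono; rewrite ?ge_max !le_max ?xy lexx !orbT.
pose m' (u : R) : nat := n (Num.max u 0).
have mm' : measurable_fun [set: R] m'.
  move=> _ B _; rewrite setTI.
  have -> : m' @^-1` B = \bigcup_(k in B) (m @^-1` [set k%:R]).
    apply/seteqP; split=> [u Bu|u [k Bk /= /eqP]]; first by exists (m' u).
    by rewrite /m eqr_nat => /eqP mk; rewrite /preimage/= /m' mk.
  by apply: bigcup_measurable => k _; rewrite -[X in measurable X]setTI; exact: mm.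
apply: (eq_measurable_fun (fun u => (-1) ^+ m' u : R)).
  move=> x; rewrite inE/= in_itv/= => /andP[ax _].
  by rewrite /m' max_l// (le_trans a0).
apply: (@measurable_funS _ _ _ _ [set: R]) => //.
exact: (measurableT_comp (f := fun k : nat => (-1) ^+ k : R)).
Qed.

Lemma integrable_sign_path (a b : R) : 0 <= a ->
  mu.-integrable `[a, b] (EFin \o (fun u => (-1) ^+ n u : R)).
Proof.
move=> a0; apply: (@measurable_bounded_integrable _ _ _ mu (fun u => (-1) ^+ n u : R)) => //.
- by apply: compact_finite_measure; exact: segment_compact.
- exact: measurable_sign_path.
- exists 1; split => // x x1 y _ /=.
  by rewrite normrX normrN1 expr1n ltW.
Qed.

Lemma signed_timeB (a b : R) : 0 <= a -> a <= b ->
  signed_time b - signed_time a = Rintegral mu `[a, b] (fun u => (-1) ^+ n u : R).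
Proof.
move=> a0 ab; rewrite /signed_time Rintegral_itvB//.
- apply: Rintegral_itv_obnd_cbnd.

  by apply: (integrableS _ _ _ (integrable_sign_path b a0)) => //;
    apply: subset_itv; rewrite bnd_simp.
- exact: integrable_sign_path.
Qed.

Lemma signed_time0 : signed_time 0 = 0.
Proof. by rewrite /signed_time set_itv1 Rintegral_set1. Qed.

Lemma signed_time_lip (a b : R) : 0 <= a -> a <= b ->
  `|signed_time b - signed_time a| <= b - a.
Proof.
move=> a0 ab; rewrite signed_timeB//.
apply: (le_trans (le_normr_Rintegral _ _)) => //.
  exact: integrable_sign_path.
under eq_Rintegral do rewrite normrX normrN1 expr1n.
by rewrite Rintegral_cst//= lebesgue_measure_itv/= lte_fin; case: ltP => //= ; lra.
Qed.

Lemma path_cst (a s b : R) : 0 <= a -> a <= s -> s <= b -> n a = n b -> n s = n a.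
Proof.
move=> a0 as_ sb nab; apply/eqP; rewrite eqn_leq {1}nab.
by rewrite !n_mono// (le_trans a0).
Qed.

Lemma signed_time_cst (a b : R) : 0 <= a -> a <= b -> n a = n b ->
  signed_time b = signed_time a + (-1) ^+ n a * (b - a).
Proof.
move=> a0 ab nab; apply/eqP; rewrite addrC -subr_eq signed_timeB//; apply/eqP.
rewrite (@eq_Rintegral _ _ _ _ _ (fun=> (-1) ^+ n a)); last first.
  move=> x; rewrite inE/= in_itv/= => /andP[ax xb].
  by rewrite (path_cst a0 ax xb).
rewrite Rintegral_cst//= lebesgue_measure_itv/= lte_fin.
case: ltP => //= ba. by congr (_ * _); lra.
Qed.

(* Only the cells on which the path jumps contribute an error, and there are at
   most [n s] of them. *)
Lemma signed_time_riemann (s : R) (p : nat) : 0 <= s ->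
  `|signed_time s - \sum_(i < p.+1) (s / p.+1%:R) * (-1) ^+ n (s * i%:R / p.+1%:R)|
  <= 2 * (s / p.+1%:R) * (n s)%:R.
Proof.
move=> s0; set d := s / p.+1%:R.
have d0 : 0 <= d by rewrite divr_ge0.
have tE i : s * i%:R / p.+1%:R = d * i%:R by rewrite /d mulrAC.
suff H j : `|signed_time (d * j%:R) - \sum_(i < j) d * (-1) ^+ n (s * i%:R / p.+1%:R)|
    <= 2 * d * (n (d * j%:R))%:R.
  have := H p.+1; suff -> : d * p.+1%:R = s by [].
  by rewrite /d divfK// pnatr_eq0.
elim: j => [|j IH].
  by rewrite mulr0 signed_time0 big_ord0 subr0 normr0 !mulr_ge0.
rewrite big_ord_recr/= tE opprD addrA.
set a := d * j%:R in IH *; set b := d * j.+1%:R.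
have ab : a <= b by rewrite ler_wpM2l// ler_nat.
have a0 : 0 <= a by rewrite mulr_ge0.
have bad : b - a = d by rewrite /b /a -mulrBr -natrB// subSnn mulr1.
have := n_mono a0 ab; rewrite leq_eqVlt => /orP[/eqP nab|nab].
  rewrite (signed_time_cst a0 ab nab) bad -nab.
  by apply: le_trans IH; rewrite le_eqVlt; apply/orP; left; apply/eqP; congr `| _ |; ring.
have L := signed_time_lip a0 ab.
have e1 : `|(-1) ^+ n a : R| = 1 by rewrite normrX normrN1 expr1n.
have nab' : 2 * d * (n a)%:R + 2 * d <= 2 * d * (n b)%:R.
  rewrite -[X in _ + X]mulr1 -mulrDr ler_wpM2l ?mulr_ge0//.
  by rewrite natr1 ler_nat.
set S := \sum_(i < j) _ in IH *.
have -> : signed_time b - S - d * (-1) ^+ n a =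
  (signed_time a - S) + (signed_time b - signed_time a) - d * (-1) ^+ n a by ring.
apply: (le_trans (ler_normB _ _)); rewrite normrM e1 mulr1 (ger0_norm d0).
have := ler_normD (signed_time a - S) (signed_time b - signed_time a).
lra.
Qed.

Lemma signed_time_le (s : R) : 0 <= s -> `|signed_time s| <= s.
Proof.
by move=> s0; have := signed_time_lip (lexx 0) s0; rewrite signed_time0 !subr0.
Qed.

(** Turns the uncountable condition defining survival into a countable one, which makes survival an
    event. The integral is 1-Lipschitz, so a negative value at [s] forces a negative value at a grid
    point shortly before [s]. *)
Lemma signed_time_ge0_grid (t : R) : 0 <= t ->
  (forall s : R, 0 <= s <= t -> 0 <= signed_time s) <->
  (forall p j : nat, (j <= p.+1)%N -> 0 <= signed_time (t * j%:R / p.+1%:R)).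
Proof.
move=> t0; split=> [H p j jp|H s /andP[s0 st]].
  apply: H; rewrite divr_ge0 ?mulr_ge0//= ler_pdivrMr ?ltr0n//.
  by rewrite ler_wpM2l// ler_nat.
move: t0; rewrite le_eqVlt => /predU1P[t0|t0].
  have -> : s = 0 by apply/eqP; rewrite eq_le s0 t0 st.
  by rewrite signed_time0.
rewrite leNgt; apply/negP => Ss.
(* This [p] makes the mesh [t / p.+1] smaller than [- signed_time s]; [j] below indexes the last
   grid point not after [s]. *)
pose p := Num.truncn (t / - signed_time s).
have pgt : t / p.+1%:R < - signed_time s.
  rewrite ltr_pdivrMr ?ltr0n// mulrC -ltr_pdivrMr ?oppr_gt0//.
  by apply: truncnS_gt.
pose j := Num.truncn (s * p.+1%:R / t).
have jle : j%:R <= s * p.+1%:R / t.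
  by rewrite truncn_le// divr_ge0 ?mulr_ge0// ltW.
have jgt : s * p.+1%:R / t < j.+1%:R by apply: truncnS_gt.
have p0 : 0 < p.+1%:R :> R by rewrite ltr0n.
have := H p j; rewrite leqNgt -ltnS => Hj.
have jp : (j < p.+2)%N.
  rewrite ltnS -(ler_nat R) (le_trans jle)// ler_pdivrMr// mulrC ler_wpM2l//.
have {}Hj := H p j jp.
set r := t * j%:R / p.+1%:R in Hj.
have r0 : 0 <= r by rewrite /r divr_ge0 ?mulr_ge0// ltW.
have rs : r <= s.
  by rewrite /r ler_pdivrMr// mulrC -ler_pdivlMr.
have srt : s - r < t / p.+1%:R.
  rewrite ltrBlDr /r -mulrDl ltr_pdivlMr// -[X in X + _]mulr1 -mulrDr.
  rewrite -ltr_pdivrMl// mulrC; rewrite -natr1 in jgt; lra.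
have := signed_time_lip r0 rs.
rewrite ler_norml => /andP[+ _]; apply/negP; rewrite -ltNge.
by rewrite ltrNr opprB ltrBrDl (lt_le_trans _ Hj)// -ltrBrDl sub0r (lt_trans srt).
Qed.

(** Right-continuity at [0] leaves a short initial interval without jumps. This is what expels paths
    with negative initial velocity from the half-line. *)
Lemma signed_time_gt0 (t : R) : 0 < t -> n 0 = 0%N ->
  (\forall r \near 0^'+, n r = n 0) -> exists2 s, 0 < s <= t & 0 < signed_time s.
Proof.
move=> t0 n0; rewrite near_withinE => -[e/= e0 He].
pose s := Num.min t (e / 2).
have s0 : 0 < s by rewrite lt_min t0 divr_gt0.
have se : s < e by rewrite gt_min; apply/orP; right; lra.
exists s; first by rewrite s0 ge_min lexx.
have ns : n s = n 0 by apply: He => //=; rewrite sub0r normrN gtr0_norm.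
by rewrite (signed_time_cst (lexx 0) (ltW s0))// n0 signed_time0 add0r subr0 mul1r.
Qed.
End Path.

(** * Independence of the past from increments *)

Section Past.
Context {R : realType} {d : measure_display} {Om : measurableType d}
  {P : probability Om R} (lam : R) (N : R -> {RV P >-> nat}).
Hypothesis hN : is_poisson_process lam N.

(* Finite-dimensional cylinders: a pi-system generating the history up to time [t]. *)
Definition past_cylinder (t : R) : set (set Om) :=
  [set E | exists2 l : seq (R * nat), all (fun p => 0 <= p.1 <= t) l
         & E = [set w | all (fun p => N p.1 w == p.2) l] ].

Definition past (t : R) : set (set Om) := <<s past_cylinder t >>.

Lemma past_cylinder_setI t : setI_closed (past_cylinder t).
Proof.
move=> _ _ [l hl ->] [l' hl' ->]; exists (l ++ l'); first by rewrite all_cat hl.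
apply/seteqP; split=> w /=; rewrite all_cat; first by case=> -> ->.
by case/andP.
Qed.

Lemma past_cylinder_setT t : past_cylinder t setT.
Proof. by exists [::] => //; apply/seteqP. Qed.

Lemma measurable_N_preimage s (B : set nat) : measurable (N s @^-1` B).
Proof. by rewrite -[X in measurable X]setTI; exact: measurable_funP. Qed.

Lemma measurable_increment r s (B : set nat) :
  measurable [set w | B (N s w - N r w)%N].
Proof.
have -> : [set w | B (N s w - N r w)%N] =
  \bigcup_(k in setT) \bigcup_(j in [set j | B (k - j)%N])
    (N s @^-1` [set k] `&` N r @^-1` [set j]).
  apply/seteqP; split=> [w Bw|w [k _] [j Bkj [/= e1 e2]]]; last by rewrite e1 e2.
  by exists (N s w) => //; exists (N r w).
apply: bigcup_measurable => k _; apply: bigcup_measurable => j _.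
by apply: measurableI; exact: measurable_N_preimage.
Qed.

Lemma past_cylinder_measurable t : past_cylinder t `<=` d.-measurable.
Proof.
move=> _ [l _ ->]; elim: l => [|p l IH] /=; first by rewrite set_true.
have -> : [set w | (N p.1 w == p.2) && all (fun q => N q.1 w == q.2) l] =
  N p.1 @^-1` [set p.2] `&` [set w | all (fun q => N q.1 w == q.2) l].
  by apply/seteqP; split=> w /=; [case/andP => /eqP ? ?|case=> -> ->; rewrite eqxx].
by apply: measurableI => //; exact: measurable_N_preimage.
Qed.

Lemma past_measurable t : past t `<=` d.-measurable.
Proof.
by apply: smallest_sub; [exact: sigma_algebra_measurable|exact: past_cylinder_measurable].
Qed.

(** Since the process starts at [0], prescribing its values amounts to prescribing its increments.
    Monotonicity of [a] is what lets the truncated differences recover the values. *)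
Lemma cylinder_increments (m : nat) (s : nat -> R) (a : nat -> nat) :
  s 0%N = 0 -> (forall i, s i <= s i.+1) -> a 0%N = 0%N ->
  (forall i, (i < m)%N -> (a i <= a i.+1)%N) ->
  [set w | forall i, (i <= m)%N -> N (s i) w = a i] =
  \bigcap_(i in `I_m) [set w | [set (a i.+1 - a i)%N] (N (s i.+1) w - N (s i) w)%N].
Proof.
move=> s0 smono a0 amono.
have spos i : 0 <= s i by elim: i => [|i IH]; rewrite ?s0// (le_trans IH).
apply/seteqP; split=> w /= H.
  by move=> i /= im; rewrite !H// ltnW.
elim=> [_|i IH im]; first by rewrite s0 a0 (poisson_start hN).
have Ei : N (s i) w = a i by apply: IH; exact: ltnW.
have := H i im; rewrite /= => E.
have le : (N (s i) w <= N (s i.+1) w)%N.  by apply: (poisson_mono hN).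
by rewrite -(subnKC le) E Ei subnKC// amono.
Qed.

Lemma cylinder_indep (t h : R) (m : nat) (s : nat -> R) (a : nat -> nat) (B : set nat) :
  s 0%N = 0 -> (forall i, s i <= s i.+1) -> a 0%N = 0%N ->
  s m.+1 = t -> s m.+2 = t + h ->
  let E := [set w | forall i, (i <= m)%N -> N (s i) w = a i] in
  let J := [set w | B (N (t + h) w - N t w)%N] in
  P (E `&` J) = (P E * P J)%E.
Proof.
move=> s0 smono a0 st sth E J.
have spos i : 0 <= s i by elim: i => [|i IH]; rewrite ?s0// (le_trans IH).
have [amono|anm] := pselect (forall i, (i < m)%N -> (a i <= a i.+1)%N); last first.
  have -> : E = set0.
    apply/seteqP; split=> // w /= Ew; apply: anm => i im.
    by rewrite -(Ew i (ltnW im)) -(Ew i.+1 im); apply: (poisson_mono hN).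
  by rewrite set0I measure0 mul0e.
(* Increments below index [m] are prescribed, the one from [s m] to [t] is free, and the one from
   [t] to [t + h] must lie in [B]. The case of a nonmonotone [a] was removed above: there the
   cylinder is empty. *)
pose C i : set nat := if (i < m)%N then [set (a i.+1 - a i)%N]
                      else if i == m then setT else B.
have EC : E = \bigcap_(i in `I_m) [set w | C i (N (s i.+1) w - N (s i) w)%N].
  rewrite /E cylinder_increments//; apply: eq_bigcapr => i /= im.
  by rewrite /C im.
have EJC : E `&` J = \bigcap_(i in `I_m.+2) [set w | C i (N (s i.+1) w - N (s i) w)%N].
  rewrite EC; apply/seteqP; split=> w /=.
    move=> [H Jw] i /=; rewrite ltnS leq_eqVlt => /predU1P[->|].
      by rewrite /C ltnNge leqnSn/= gtn_eqF// st sth.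
    rewrite ltnS leq_eqVlt => /predU1P[->|]; last exact: H.
    by rewrite /C ltnn eqxx.
  move=> H; split=> [i /= im|]; first by apply: H => /=; rewrite (ltn_trans im) ?ltnS// ltnW.
  by have := H m.+1 (ltnSn _); rewrite /= /C ltnNge leqnSn/= gtn_eqF// st sth.
rewrite EJC (poisson_indep hN)//.
rewrite 2!big_ord_recr/= EC (poisson_indep hN)//.
rewrite {2}/C ltnn eqxx {2}/C ltnNge leqnSn/= gtn_eqF// st sth.
by rewrite [X in (_ * P X * _)%E](_ : _ = setT)// probability_setT mule1.
Qed.

Lemma past_cylinder_indep (t h : R) (E : set Om) (B : set nat) : 0 <= t -> 0 <= h ->
  past_cylinder t E ->
  let J := [set w | B (N (t + h) w - N t w)%N] in
  P (E `&` J) = (P E * P J)%E.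
Proof.
move=> t0 h0 [l0 hl0 EE] J.
pose le1 (p q : R * nat) := p.1 <= q.1.
pose l := sort le1 l0.
have hl : all (fun p => 0 <= p.1 <= t) l by rewrite all_sort.
have El : E = [set w | all (fun p => N p.1 w == p.2) l].
  by rewrite EE; apply/seteqP; split=> w /=; rewrite all_sort.
have lsort : sorted le1 l by apply: sort_sorted => p q; exact: le_total.
clearbody l; clear l0 hl0 EE.
pose m := size l.
(* The subdivision is [0], the sorted observation times, then [t]; the default [t + h] of [nth]
   supplies the next time and keeps the sequence constant afterwards. *)
pose ss := 0 :: rcons [seq p.1 | p <- l] t.
pose s i := nth (t + h) ss i.
pose a i := nth 0%N (0%N :: [seq p.2 | p <- l]) i.
have ss_sort : sorted <=%R ss.
  have : all (fun p => 0 <= p.1) l by apply: sub_all hl => p /andP[].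
  have : all (fun p => p.1 <= t) l by apply: sub_all hl => p /andP[].
  move=> hle hge; rewrite /ss /= rcons_path path_min_sorted ?all_map// sorted_map lsort/=.
  elim/last_ind: l hle {hge lsort hl El m ss s a} => [//|l p _].
  by rewrite map_rcons last_rcons all_rcons => /andP[].
have ssize : size ss = m.+2 by rewrite /= size_rcons size_map.
have := @cylinder_indep t h m s a B.
have -> : [set w | forall i, (i <= m)%N -> N (s i) w = a i] = E.
  rewrite El; apply/seteqP; split=> w /=.
    move=> H; apply/(all_nthP (0, 0%N)) => i im; apply/eqP.
    have := H i.+1 im; rewrite /s /a /= nth_rcons size_map im.
    by rewrite (nth_map (0, 0%N))// (nth_map (0, 0%N)).
  move=> /(all_nthP (0, 0%N)) H [_|i im]; first exact: (poisson_start hN).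
  rewrite /s /a /= nth_rcons size_map im.
  by rewrite (nth_map (0, 0%N))// (nth_map (0, 0%N))//; apply/eqP/H.
apply.
- by [].
- move=> i; have [im|im] := ltnP i.+1 m.+2.
    by apply: (sortedP (t + h) ss_sort); rewrite ssize.
  rewrite [leRHS]nth_default ?ssize//.
  move: im; rewrite leq_eqVlt => /predU1P[[<-]|im].
    by rewrite /s /= nth_rcons size_map ltnn eqxx lerDl.
  by rewrite /s nth_default// ssize.
- by [].
- by rewrite /s /= nth_rcons size_map ltnn eqxx.
- by rewrite /s nth_default// ssize.
Qed.

(** Both sides, as functions of [E], are finite measures that agree on the pi-system of cylinders,
    hence on the sigma-algebra it generates. *)
Lemma past_indep (t h : R) (E : set Om) (B : set nat) : 0 <= t -> 0 <= h ->
  past t E ->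
  let J := [set w | B (N (t + h) w - N t w)%N] in
  P (E `&` J) = (P E * P J)%E.
Proof.
move=> t0 h0 pE J.
have mJ : measurable J by exact: measurable_increment.
have PJ0 : 0 <= fine (P J) by exact: fine_ge0.
have PJE : P J = (fine (P J))%:E by rewrite fineK// fin_num_measure.
rewrite muleC PJE.
pose m1 := mrestr P mJ; pose m2 := mscale (NngNum PJ0) P.
apply: (g_sigma_algebra_measure_unique (past_cylinder t) (@past_cylinder_measurable t)
  (fun=> setT) _ _ m1 m2 (@past_cylinder_setI t)) => //.
- by move=> _; exact: past_cylinder_setT.
- by rewrite bigcup_const//; exists 0%N.
- move=> A cA; transitivity (P A * P J)%E; first exact: past_cylinder_indep.
  by rewrite muleC; congr (_ * _)%E.
- move=> _; rewrite /m1 /mrestr (le_lt_trans (probability_le1 P _)) ?ltry//.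
  exact: measurableI.
Qed.

(** The sample space with the history up to [t] as its sigma-algebra, so that being determined by
    the past is ordinary measurability. *)
Definition past_type (t : R) := g_sigma_algebraType (past_cylinder t).

Lemma measurable_N_past (t s : R) : 0 <= s <= t ->
  measurable_fun [set: past_type t] (N s).
Proof.
move=> st _ B _; rewrite setTI.
have -> : N s @^-1` B = \bigcup_(k in B) (N s @^-1` [set k]).
  by apply/seteqP; split=> [w Bw|w [k Bk /= e]]; [exists (N s w)|rewrite e].
apply: bigcup_measurable => k _; apply: sub_sigma_algebra.
exists [:: (s, k)]; first by rewrite /= st.
by apply/seteqP; split=> w /=; rewrite andbT => /eqP.
Qed.

(** Needed because the independence of the initial velocity is stated for the sigma-algebra of the
    whole process. *)
Lemma past_sigma_process t : past t `<=` sigma_process N.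
Proof.
rewrite /sigma_process; set G := (X in <<s X >>).
apply: smallest_sub; first exact: smallest_sigma_algebra.
move=> _ [l hl ->]; elim: l hl => [_|p l IH /= /andP[/andP[p0 _] hl]].
  by rewrite /= set_true; exact: (@measurableT _ (g_sigma_algebraType G)).
have -> : [set w | (N p.1 w == p.2) && all (fun q => N q.1 w == q.2) l] =
  N p.1 @^-1` [set p.2] `&` [set w | all (fun q => N q.1 w == q.2) l].
  by apply/seteqP; split=> w /=; [case/andP => /eqP ? ?|case=> -> ->; rewrite eqxx].
apply: (@measurableI _ (g_sigma_algebraType G)); last exact: IH.
by apply: sub_sigma_algebra; exists p.1, [set p.2].
Qed.

End Past.

(** * Survival probabilities with a given number of jumps *)

Section IncrementEstimates.
Context {R : realType}.
Implicit Types (u v a b C : R).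

(** Mean value bounds for a power. They give the explicit polynomials the same kind of two-sided
    one-step estimate as the probabilities. *)
Lemma subrX_bounds (m : nat) u v : 0 <= v -> v <= u ->
  m.+1%:R * v ^+ m * (u - v) <= u ^+ m.+1 - v ^+ m.+1
  <= m.+1%:R * u ^+ m * (u - v).
Proof.
move=> v0 vu; have u0 : 0 <= u by exact: le_trans vu.
have uv0 : 0 <= u - v by rewrite subr_ge0.
elim: m => [|m /andP[IH1 IH2]]; first by rewrite !expr0 !expr1 !mul1r lexx.
have -> : u ^+ m.+2 - v ^+ m.+2 = u * (u ^+ m.+1 - v ^+ m.+1) + v ^+ m.+1 * (u - v).
  by rewrite !(exprS _ m.+1); ring.
have vm0 : 0 <= v ^+ m.+1 * (u - v) by rewrite mulr_ge0 ?exprn_ge0.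
have vmu : v ^+ m.+1 * (u - v) <= u ^+ m.+1 * (u - v).
  by rewrite ler_wpM2r// lerXn2r ?nnegrE.
rewrite -(natr1 m.+1) !mulrDl !mul1r; apply/andP; split.
  rewrite lerD2r (le_trans _ (ler_wpM2l u0 IH1))//.
  rewrite [leLHS](_ : _ = v * (m.+1%:R * v ^+ m * (u - v))); last by rewrite exprS; ring.
  by rewrite ler_wpM2r// !mulr_ge0 ?exprn_ge0.
apply: lerD => //; apply: (le_trans (ler_wpM2l u0 IH2)).
by rewrite exprS !mulrA (mulrC u) lexx.
Qed.

(* The first error term telescopes, so over [m] equal steps the errors add up to O(1 / m). *)
Lemma telescoping_cst (D phi : R -> R) a b C : a <= b ->
  (forall r h : R, a <= r -> 0 < h -> r + h <= b ->
     `|D (r + h) - D r| <= h * (phi (r + h) - phi r) + C * h ^+ 2) ->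
  D b = D a.
Proof.
rewrite le_eqVlt => /predU1P[->//|ab H].
(* With [m.+1] steps of length [h = (b - a) / m.+1], the telescoped error
   [h * (phi b - phi a) + C * h ^+ 2 * m.+1] equals [K / m.+1]. *)
pose K := (b - a) * (phi b - phi a + C * (b - a)).
have HK m : `|D b - D a| <= K / m.+1%:R.
  pose h := (b - a) / m.+1%:R.
  have m0 : (m.+1%:R : R) != 0 by rewrite pnatr_eq0.
  have h0 : 0 < h by rewrite divr_gt0 ?subr_gt0.
  have hm : h * m.+1%:R = b - a by rewrite /h divfK.
  have Hj j : (j <= m.+1)%N -> `|D (a + h * j%:R) - D a|
      <= h * (phi (a + h * j%:R) - phi a) + C * h ^+ 2 * j%:R.
    elim: j => [_|j IH jm]; first by rewrite !mulr0 !addr0 !subrr normr0 mulr0.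
    have e : a + h * j.+1%:R = (a + h * j%:R) + h by rewrite -natr1; ring.
    rewrite e; set r := a + h * j%:R.
    have ar : a <= r by rewrite /r lerDl mulr_ge0// ltW.
    have rb : r + h <= b.
      by rewrite -e -lerBrDl -hm (ler_wpM2l (ltW h0))// ler_nat.
    have := H r h ar h0 rb; have := IH (ltnW jm); rewrite -/r.
    have := ler_normD (D (r + h) - D r) (D r - D a).
    rewrite addrA subrK -(natr1 j).
    move: (phi _) (phi _) (phi _) (D _) (D _) (D _) => p1 p2 p3 d1 d2 d3; lra.
  have := Hj m.+1 (leqnn _); rewrite hm subrKC.
  move/le_trans; apply; rewrite /K.
  suff -> : C * h ^+ 2 * m.+1%:R = h * (C * (b - a)).
    by rewrite -mulrDr /h mulrAC.
  by rewrite -hm; ring.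
apply/eqP; rewrite -subr_eq0 -normr_le0 leNgt; apply/negP => x0.
have := HK (Num.truncn (K / `|D b - D a|)).
rewrite ler_pdivlMr ?ltr0n// leNgt => /negP; apply.
by rewrite mulrC -ltr_pdivrMr// truncnS_gt.
Qed.

End IncrementEstimates.

Section Survival.
Context {R : realType} {d : measure_display} {Om : measurableType d}
  {P : probability Om R} (lam c : R) (N : R -> {RV P >-> nat}).
Hypotheses (hlam : 0 < lam) (hc : 0 < c).
Hypothesis hN : is_poisson_process lam N.

Definition signed_clock (s : R) (w : Om) : R := signed_time (fun u => N u w) s.

Definition survival (t : R) : set Om :=
  [set w | forall s : R, 0 <= s <= t -> 0 <= signed_clock s w].

(* The defective law of [(T t, N t)] on survival up to [t], started with speed [c]. *)
Definition survival_tail (n : nat) (x t : R) : set Om :=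
  [set w | [/\ x <= c * signed_clock t w, survival t w & N t w = n] ].

Let mono w : forall r s : R, 0 <= r -> r <= s -> (N r w <= N s w)%N.
Proof. by move=> r s; exact: (poisson_mono hN). Qed.

(** The position is a pointwise limit of Riemann sums, each of which reads [N] only at times up to
    [s]. *)
Lemma measurable_signed_clock_past (t s : R) : 0 <= s <= t ->
  measurable_fun [set: past_type N t] (signed_clock s).
Proof.
move=> /andP[s0 st].
pose h (p : nat) (w : past_type N t) : R :=
  \sum_(i < p.+1) (s / p.+1%:R) * (-1) ^+ N (s * i%:R / p.+1%:R) w.
apply: (@measurable_fun_cvg _ _ _ _ h).
  move=> p; apply: measurable_sum => i; apply: measurable_funM => //.
  apply: (measurableT_comp (f := fun k : nat => (-1) ^+ k : R)) => //.
  apply: measurable_N_past; rewrite divr_ge0 ?mulr_ge0//=.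
  rewrite (le_trans _ st)// ler_pdivrMr ?ltr0n// ler_wpM2l//.
  by rewrite ler_nat ltnW.
move=> w _; apply/cvgrPdist_le => e e0; near=> p.
apply: (le_trans (signed_time_riemann (mono w) p s0)).
rewrite mulrA mulrAC ler_pdivrMr ?ltr0n// -ler_pdivrMl//.
near: p; have [K _ HK] := @nbhs_infty_ger R (e^-1 * (2 * s * (N s w)%:R)).
by exists K => // p /= Kp; rewrite (le_trans (HK p Kp))// ler_nat.
Unshelve. all: end_near. Qed.

Lemma survivalE (t : R) : 0 <= t -> survival t =
  \bigcap_(p in setT) \bigcap_(j in [set j | (j <= p.+1)%N])
    (signed_clock (t * j%:R / p.+1%:R) @^-1` `[0, +oo[).
Proof.
move=> t0; apply/seteqP; split=> w.
  move/(signed_time_ge0_grid (mono w) t0) => H p _ j /= jp.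
  by rewrite in_itv/= andbT; exact: H.
move=> H; apply/(signed_time_ge0_grid (mono w) t0) => p j jp.
by have := H p I j jp; rewrite /= in_itv/= andbT.
Qed.

Lemma survival_past (t : R) : 0 <= t -> past N t (survival t).
Proof.
move=> t0; rewrite survivalE//.
apply: (@bigcap_measurable _ (past_type N t)) => // p _.
apply: (@bigcap_measurable _ (past_type N t)) => [|j /= jp]; first by exists 0%N.
rewrite -[X in measurable X]setTI; apply: measurable_signed_clock_past => //.
rewrite divr_ge0 ?mulr_ge0//= ler_pdivrMr ?ltr0n// ler_wpM2l//.
by rewrite ler_nat.
Qed.

Lemma survival_tail_past (n : nat) (x t : R) : 0 <= t ->
  past N t (survival_tail n x t).
Proof.
move=> t0; have -> : survival_tail n x t =
  signed_clock t @^-1` `[x / c, +oo[ `&` (survival t `&` N t @^-1` [set n]).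
  apply/seteqP; split=> w /=; rewrite in_itv/= andbT ler_pdivrMr// mulrC.
    by case.
  by case=> ? [].
have tt : 0 <= t <= t by rewrite t0 lexx.
apply: (@measurableI _ (past_type N t)); last apply: (@measurableI _ (past_type N t)).
- by rewrite -[X in measurable X]setTI; apply: measurable_signed_clock_past.
- exact: survival_past.
- by rewrite -[X in measurable X]setTI; apply: (measurable_N_past tt).
Qed.

Lemma survival_tail_measurable (n : nat) (x t : R) : 0 <= t ->
  measurable (survival_tail n x t).
Proof. by move=> t0; apply: past_measurable; exact: survival_tail_past. Qed.

Definition tail_prob (n : nat) (x t : R) : R := fine (P (survival_tail n x t)).

Lemma tail_prob_ge0 n x t : 0 <= tail_prob n x t.
Proof. exact: fine_ge0. Qed.

Lemma fine_prob_le (A B : set Om) : measurable A -> measurable B -> A `<=` B ->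
  fine (P A) <= fine (P B).
Proof.
by move=> mA mB AB; rewrite fine_le ?fin_num_measure// le_measure ?inE.
Qed.

Lemma fine_prob_setU (A B : set Om) : measurable A -> measurable B ->
  A `&` B = set0 -> fine (P (A `|` B)) = fine (P A) + fine (P B).
Proof.
move=> mA mB AB; rewrite measureU//.
by rewrite fineD ?fin_num_measure.
Qed.

(** Survival already makes the position nonnegative at time [t], so a negative level imposes
    nothing. This gives meaning to steps that cross the level [0]. *)
Lemma survival_tail_le0 n x t : 0 <= t -> x <= 0 ->
  survival_tail n x t = survival_tail n 0 t.
Proof.
move=> t0 x0; apply/seteqP; split=> w [xS Sw Nw]; split=> //.
  by rewrite mulr_ge0 ?(ltW hc)//; apply: Sw; rewrite t0 lexx.
exact: le_trans xS.
Qed.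

Definition jumps (t h : R) (k : nat) : set Om := [set w | (N (t + h) w - N t w)%N = k].

Lemma jumps_measurable t h k : measurable (jumps t h k).
Proof. exact: (measurable_increment N t (t + h) [set k]). Qed.

Section Increment.
Variables (t h : R).
Hypotheses (t0 : 0 <= t) (h0 : 0 < h).

Lemma jumps0 : fine (P (jumps t h 0)) = expR (- (lam * h)).
Proof.
have -> : P (jumps t h 0) = (poisson_pmf (lam * (t + h - t)) 0)%:E.
  by apply: (poisson_increment hN) => //; rewrite ltrDl.
by rewrite addrAC subrr add0r /poisson_pmf mulr_gt0// expr0 fact0 divr1 mul1r.
Qed.

Lemma jumps1 : fine (P (jumps t h 1)) = lam * h * expR (- (lam * h)).
Proof.
have -> : P (jumps t h 1) = (poisson_pmf (lam * (t + h - t)) 1)%:E.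
  by apply: (poisson_increment hN) => //; rewrite ltrDl.
by rewrite addrAC subrr add0r /poisson_pmf mulr_gt0// expr1 divr1.
Qed.

Lemma prob_jump : fine (P (~` jumps t h 0)) <= lam * h.
Proof.
have mJ0 := jumps_measurable t h 0.
rewrite probability_setC// fineB ?fin_num_measure// jumps0/=.
have := expR_ge1Dx (- (lam * h)); lra.
Qed.

Lemma prob_jumps2 : fine (P (~` (jumps t h 0 `|` jumps t h 1))) <= (lam * h) ^+ 2.
Proof.
have mJ0 := jumps_measurable t h 0; have mJ1 := jumps_measurable t h 1.
have mU : measurable (jumps t h 0 `|` jumps t h 1) by exact: measurableU.
rewrite probability_setC// fineB ?fin_num_measure// fine_prob_setU//; last first.
  by apply/seteqP; split=> // w; rewrite /jumps /= => -[->].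
rewrite jumps0 jumps1/=.
have u0 : 0 <= lam * h by rewrite mulr_ge0// ltW.
have := expR_ge1Dx (- (lam * h)); move: (expR _) => e; move: (lam * h) u0 => u u0 H.
(* From [expR (- u) >= 1 - u], the probability of at most one jump, [(1 + u) * expR (- u)], is at
   least [1 - u ^+ 2]. *)
have := ler_wpM2l (addr_ge0 ler01 u0) H; lra.
Qed.

(** Splits on the number of jumps in []t, t + h]]. Without a jump [A'] coincides with [A], with one
    jump it lies between [L] and [U], and two or more jumps cost at most [(lam * h) ^+ 2]. The
    weight [expR (lam * (t + h))] cancels the factor [expR (- (lam * h))] common to the
    probabilities of zero and one jump. *)
Lemma survival_step (A A' U L : set Om) :
  past N t A -> past N t U -> past N t L -> measurable A' ->
  A' `&` jumps t h 0 = A `&` jumps t h 0 ->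
  A' `&` jumps t h 1 `<=` U -> L `&` jumps t h 1 `<=` A' ->
  expR (lam * t) * (fine (P A) + lam * h * fine (P L))
  <= expR (lam * (t + h)) * fine (P A')
  <= expR (lam * t) * (fine (P A) + lam * h * fine (P U))
     + expR (lam * (t + h)) * (lam * h) ^+ 2.
Proof.
move=> pA pU pL mA' E0 E1 E2.
have mJ0 := jumps_measurable t h 0; have mJ1 := jumps_measurable t h 1.
have mA := past_measurable pA; have mU := past_measurable pU.
have mL := past_measurable pL.
set J0 := jumps t h 0 in E0 mJ0 *; set J1 := jumps t h 1 in E1 E2 mJ1 *.
have J01 : J0 `&` J1 = set0 by apply/seteqP; split=> // w; rewrite /J0 /J1 /jumps /= => -[->].
have indep E k : past N t E ->
    fine (P (E `&` jumps t h k)) = fine (P E) * fine (P (jumps t h k)).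
  move=> pE; rewrite -fineM ?fin_num_measure//; last 2 first.
  - exact: past_measurable pE.
  - exact: jumps_measurable.
  by congr fine; apply: (past_indep hN [set k]) => //; exact: ltW.
have dJ X Y : (X `&` J0) `&` (Y `&` J1) = set0 by rewrite setIACA J01 setI0.
have eh : expR (lam * (t + h)) = expR (lam * t) * expR (lam * h).
  by rewrite mulrDr expRD.
have ee : expR (lam * h) * expR (- (lam * h)) = 1 by rewrite -expRD subrr expR0.
have key X : expR (lam * (t + h)) * (X * expR (- (lam * h))) = expR (lam * t) * X.
  transitivity (expR (lam * t) * X * (expR (lam * h) * expR (- (lam * h)))).
    by rewrite eh; ring.
  by rewrite ee mulr1.
apply/andP; split.
  have : fine (P ((A `&` J0) `|` (L `&` J1))) <= fine (P A').
    apply: fine_prob_le => //; first by apply: measurableU; exact: measurableI.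
    by move=> w [|/E2//]; rewrite -E0 => -[].
  rewrite fine_prob_setU//; [|exact: measurableI|exact: measurableI].
  rewrite !indep// jumps0 jumps1.
  move/(ler_wpM2l (ltW (expR_gt0 (lam * (t + h))))); apply: le_trans.
  rewrite le_eqVlt; apply/orP; left; apply/eqP; rewrite -key; ring.
have : fine (P A') <= fine (P ((A `&` J0) `|` (U `&` J1) `|` ~` (J0 `|` J1))).
  apply: fine_prob_le => //.
    apply: measurableU; first by apply: measurableU; exact: measurableI.
    by apply: measurableC; exact: measurableU.
  move=> w A'w; have [J0w|J0w] := pselect (J0 w).
    by left; left; rewrite -E0.
  have [J1w|J1w] := pselect (J1 w); first by left; right; split => //; exact: E1.
  by right=> -[].
rewrite fine_prob_setU//; last 3 first.
- by apply: measurableU; exact: measurableI.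
- by apply: measurableC; exact: measurableU.
- apply/seteqP; split=> // w [[[_ ?]|[_ ?]]] H; apply: H; [left|right] => //.
rewrite fine_prob_setU//; [|exact: measurableI|exact: measurableI].
rewrite !indep// jumps0 jumps1 => H.
have := le_trans H (lerD (lexx _) prob_jumps2).
move/(ler_wpM2l (ltW (expR_gt0 (lam * (t + h))))) => /le_trans; apply.
rewrite mulrDr lerD2r.
rewrite le_eqVlt; apply/orP; left; apply/eqP; rewrite -key; ring.
Qed.

End Increment.

End Survival.

(** * One-step inequalities along the two families of characteristic lines *)

Section SurvivalSteps.
Context {R : realType} {d : measure_display} {Om : measurableType d}
  {P : probability Om R} (lam c : R) (N : R -> {RV P >-> nat}).
Hypotheses (hlam : 0 < lam) (hc : 0 < c).
Hypothesis hN : is_poisson_process lam N.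

Local Notation S := (signed_clock N).
Local Notation F := (tail_prob c N).

Let mono w : forall r s : R, 0 <= r -> r <= s -> (N r w <= N s w)%N.
Proof. by move=> r s; exact: (poisson_mono hN). Qed.

Lemma signed_clock_lip w (a b : R) : 0 <= a -> a <= b ->
  S a w - (b - a) <= S b w <= S a w + (b - a).
Proof.
move=> a0 ab; have := signed_time_lip (mono w) a0 ab; rewrite ler_norml -/(S b w) -/(S a w).
move: (S b w) (S a w) => y z /andP[]; lra.
Qed.

Lemma no_jumpP t h w : 0 <= t -> 0 <= h -> jumps N t h 0 w -> N (t + h) w = N t w.
Proof.
move=> t0 h0; rewrite /jumps/= => /eqP; rewrite subn_eq0 => le.
by apply/eqP; rewrite eqn_leq le mono// lerDl.
Qed.

Lemma one_jumpP t h w : 0 <= t -> 0 <= h -> jumps N t h 1 w ->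
  N (t + h) w = (N t w).+1.
Proof.
move=> t0 h0; rewrite /jumps/= => /eqP; rewrite -(eqn_add2r (N t w)) subnK ?add1n => [/eqP//|].
by rewrite mono// lerDl.
Qed.

Lemma survival_widen (t h : R) w : 0 <= t -> 0 <= h -> survival N t w ->
  (forall s : R, t <= s <= t + h -> 0 <= S s w) -> survival N (t + h) w.
Proof.
move=> t0 h0 Sw Sth s /andP[s0 sth].
by have [st|/ltW st] := leP s t; [apply: Sw; rewrite s0|apply: Sth; rewrite st].
Qed.

Lemma survival_narrow (t h : R) : 0 <= h -> survival N (t + h) `<=` survival N t.
Proof.
by move=> h0 w Sw s /andP[s0 st]; apply: Sw; rewrite s0 (le_trans st)// lerDl.
Qed.

(* In [odd_step] and [even_step] the velocity at time [t], given no jump after it, is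
   [- c] resp. [c]; a single jump in between moves the position by at most [c * h]. *)
Lemma odd_step (m : nat) (x t h : R) : ~~ odd m -> 0 <= t -> 0 < h -> c * h <= x ->
  expR (lam * t) * (F m.+1 x t + lam * h * F m x t)
  <= expR (lam * (t + h)) * F m.+1 (x - c * h) (t + h)
  <= expR (lam * t) * (F m.+1 x t + lam * h * F m (x - 2 * (c * h)) t)
     + expR (lam * (t + h)) * (lam * h) ^+ 2.
Proof.
move=> om t0 h0 xh; have h0' := ltW h0.
have th0 : 0 <= t + h by rewrite addr_ge0.
have lip w s : t <= s <= t + h -> S t w - h <= S s w.
  move=> /andP[ts sth]; have /andP[+ _] := signed_clock_lip w t0 ts; lra.
(* The hypothesis [c * h <= x] is used here: a path at or above [x] at time [t] cannot cross [0]
   within a time [h], so survival extends to [t + h]. *)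
have ge0 w s : x <= c * S t w -> t <= s <= t + h -> 0 <= S s w.
  move=> xS /(lip w); apply: le_trans; rewrite -(pmulr_rge0 _ hc) mulrBr; lra.
have thth : t <= t + h <= t + h by rewrite lexx lerDl h0'.
apply: (survival_step hlam hN t0 h0).
- exact: (survival_tail_past hc hN).
- exact: (survival_tail_past hc hN).
- exact: (survival_tail_past hc hN).
- exact: (survival_tail_measurable hc hN).
- apply/seteqP; split=> w [[xS Sw Nw] J0]; split=> //;
    have Nth := no_jumpP t0 h0' J0.
    have e : S (t + h) w = S t w - h.
      rewrite /signed_clock (signed_time_cst (mono w) t0 (b := t + h)) ?lerDl//.
      by rewrite -Nth Nw -signr_odd/= om expr1; ring.
    split; [|exact: survival_narrow Sw|by rewrite -Nth].
    by move: xS; rewrite e mulrBr; lra.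
  split; [|by apply: survival_widen => // s; exact: ge0|by rewrite Nth].
  have := lip w _ thth; rewrite -(ler_pM2l hc) mulrBr; lra.
- move=> w [[xS Sw Nw] J1]; split; [|exact: survival_narrow Sw|].
    have /andP[_] := signed_clock_lip w t0 (proj1 (andP thth)).
    rewrite -(ler_pM2l hc) mulrDr; have -> : t + h - t = h by ring.
    lra.
  by have := one_jumpP t0 h0' J1; rewrite Nw => -[].
- move=> w [[xS Sw Nw] J1]; split; [|by apply: survival_widen => // s; exact: ge0|].
    have := lip w _ thth; rewrite -(ler_pM2l hc) mulrBr; lra.
  by rewrite (one_jumpP t0 h0' J1) Nw.
Qed.

Lemma even_step (m : nat) (x t h : R) : odd m -> 0 <= t -> 0 < h ->
  expR (lam * t) * (F m.+1 x t + lam * h * F m (Num.max x 0 + 2 * (c * h)) t)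
  <= expR (lam * (t + h)) * F m.+1 (x + c * h) (t + h)
  <= expR (lam * t) * (F m.+1 x t + lam * h * F m x t)
     + expR (lam * (t + h)) * (lam * h) ^+ 2.
Proof.
move=> om t0 h0; have h0' := ltW h0.
have th0 : 0 <= t + h by rewrite addr_ge0.
have ch0 : 0 < c * h by rewrite mulr_gt0.
have lip w s : t <= s <= t + h -> S t w - h <= S s w.
  move=> /andP[ts sth]; have /andP[+ _] := signed_clock_lip w t0 ts; lra.
have thth : t <= t + h <= t + h by rewrite lexx lerDl h0'.
have up w : S (t + h) w <= S t w + h.
  have /andP[_] := signed_clock_lip w t0 (proj1 (andP thth)).
  by have -> : t + h - t = h by ring.
apply: (survival_step hlam hN t0 h0).
- exact: (survival_tail_past hc hN).
- exact: (survival_tail_past hc hN).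
- exact: (survival_tail_past hc hN).
- exact: (survival_tail_measurable hc hN).
- apply/seteqP; split=> w [[xS Sw Nw] J0]; split=> //;
    have Nth := no_jumpP t0 h0' J0.
    split; [|exact: survival_narrow Sw|by rewrite -Nth].
    by have := up w; rewrite -(ler_pM2l hc) mulrDr; lra.
  have e s : t <= s <= t + h -> S s w = S t w + (s - t).
    move=> /andP[ts sth].
    have Ns : N s w = N t w.
      exact: (path_cst (mono w) t0 ts sth).
    rewrite /signed_clock (signed_time_cst (mono w) t0 ts)// Nw.
    by rewrite -signr_odd/= om expr0 mul1r.
  split; [|apply: survival_widen => // s sI|by rewrite Nth].
    rewrite e// mulrDr; have -> : t + h - t = h by ring.
    lra.
  rewrite e//; apply: addr_ge0; first by apply: Sw; rewrite t0 lexx.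
  by case/andP: sI => ts _; rewrite subr_ge0.
- move=> w [[xS Sw Nw] J1]; split; [|exact: survival_narrow Sw|].
    by have := up w; rewrite -(ler_pM2l hc) mulrDr; lra.
  by have := one_jumpP t0 h0' J1; rewrite Nw => -[].
- move=> w [[xS Sw Nw] J1].
  (* The level in the lower event serves twice: its part [x + 2 * (c * h)] brings the path above
     [x + c * h] at the end, and its part [2 * (c * h)] keeps the path nonnegative meanwhile, which
     matters when [x] is negative. *)
  have x1 : x + 2 * (c * h) <= c * S t w.
    by apply: le_trans xS; rewrite lerD2r le_max lexx.
  have x2 : 2 * (c * h) <= c * S t w.
    by apply: le_trans xS; rewrite lerDr le_max lexx orbT.
  split; last by rewrite (one_jumpP t0 h0' J1) Nw.
    have := lip w _ thth; rewrite -(ler_pM2l hc) mulrBr; lra.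
  apply: survival_widen => // s /(lip w); apply: le_trans.
  rewrite -(pmulr_rge0 _ hc) mulrBr; lra.
Qed.

End SurvivalSteps.

(** * Closed form of the tail probabilities, by induction on the number of jumps *)

Section SurvivalFormula.
Context {R : realType} {d : measure_display} {Om : measurableType d}
  {P : probability Om R} (lam c : R) (N : R -> {RV P >-> nat}).
Hypotheses (hlam : 0 < lam) (hc : 0 < c).
Hypothesis hN : is_poisson_process lam N.

Local Notation F := (tail_prob c N).

Definition tail_coef (a b : nat) : R :=
  (lam / (2 * c)) ^+ (a + b) / (a`!%:R * b`!%:R).

Lemma tail_coef_ge0 a b : 0 <= tail_coef a b.
Proof.
by rewrite divr_ge0 ?mulr_ge0// exprn_ge0// divr_ge0 ?mulr_ge0// ltW.
Qed.

Lemma tail_coefC a b : tail_coef a b = tail_coef b a.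
Proof. by rewrite /tail_coef addnC [X in _ / X]mulrC. Qed.

(** Matches the derivative of the closed form to [lam] times the previous one: along a
    characteristic the growing factor has slope [2 * c] in time. *)
Lemma tail_coefS a b : tail_coef a.+1 b * a.+1%:R * (2 * c) = lam * tail_coef a b.
Proof.
rewrite /tail_coef addSn exprS factS natrM.
have fn0 (n : nat) : (n`!%:R : R) != 0 by rewrite pnatr_eq0 -lt0n fact_gt0.
have c0 : c != 0 by rewrite gt_eqF.
by field; rewrite !fn0 c0 addrC natr1 pnatr_eq0.
Qed.

Lemma tail_prob_max n x t : 0 <= t -> F n x t = F n (Num.max x 0) t.
Proof.
move=> t0; case: leP => // x0; rewrite /tail_prob.
by rewrite (survival_tail_le0 N hc n t0 x0).
Qed.

Lemma tail_prob_time0 n x : (0 < n)%N -> F n x 0 = 0.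
Proof.
move=> n0; rewrite /tail_prob (_ : survival_tail _ _ _ _ _ = set0) ?measure0//.
apply/seteqP; split=> // w [_ _ Nw].
by move: n0; rewrite -Nw (poisson_start hN).
Qed.

(** Position [c * t] requires velocity [c] throughout, whereas an odd count means velocity [- c] at
    time [t]. So a jump occurs in the last [h] units of time, with probability at most [lam * h] for
    arbitrarily small [h]. *)
Lemma tail_prob_boundary n t : odd n -> 0 <= t -> F n (c * t) t = 0.
Proof.
move=> on; rewrite le_eqVlt => /predU1P[<-|t0].
  by rewrite tail_prob_time0//; case: n on.
apply/eqP; rewrite eq_le tail_prob_ge0 andbT; apply/ler_addgt0Pr => e e0.
rewrite add0r; pose h := Num.min (t / 2) (e / lam).
have h0 : 0 < h by rewrite lt_min !divr_gt0.
have ht : h < t by rewrite gt_min ltr_pdivrMr// ltr_pMr// ltr1n.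
have he : lam * h <= e.
  by rewrite mulrC -ler_pdivlMr// ge_min lexx orbT.
have th0 : 0 <= t - h by rewrite subr_ge0 ltW.
apply: le_trans he; apply: (le_trans _ (prob_jump hlam hN th0 h0)).
apply: fine_prob_le.
- exact: (survival_tail_measurable hc hN _ _ (ltW t0)).
- by apply: measurableC; exact: jumps_measurable.
move=> w [xS Sw Nw] /(no_jumpP hN th0 (ltW h0)); rewrite subrK => e1.
move: xS; rewrite ler_pM2l// leNgt => /negP; apply.
have mono : forall r s : R, 0 <= r -> r <= s -> (N r w <= N s w)%N.
  by move=> r s; exact: (poisson_mono hN).
have tht : t - h <= t by rewrite lerBlDr lerDl ltW.
rewrite /signed_clock (signed_time_cst mono th0 tht)// -e1 Nw.
rewrite -signr_odd on/= expr1.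
have := le_trans (ler_norm _) (signed_time_le mono th0).
rewrite -(ltrD2r (- t)); move: (signed_time _ _) => z; lra.
Qed.

Lemma tail_prob_base t x : 0 <= t -> 0 <= x <= c * t ->
  expR (lam * t) * F 0 x t = 1.
Proof.
move=> t0 /andP[x0 xct].
have mono w : forall r s : R, 0 <= r -> r <= s -> (N r w <= N s w)%N.
  by move=> r s; exact: (poisson_mono hN).
have e : survival_tail c N 0 x t = [set w | (N t w - N 0 w)%N = 0%N].
  apply/seteqP; split=> w; first by case=> _ _ /= ->.
  rewrite /= (poisson_start hN) subn0 => Nt.
  have S s : 0 <= s <= t -> signed_clock N s w = s.
    move=> /andP[s0 st]; have Ns := path_cst (mono w) (lexx 0) s0 st.
    rewrite /signed_clock (signed_time_cst (mono w) (lexx 0) s0); last first.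
      by rewrite Ns// Nt (poisson_start hN).
    by rewrite signed_time0 (poisson_start hN) expr0; ring.
  split=> // [|s sI]; first by rewrite S// t0 lexx.
  by rewrite S//; case/andP: sI.
rewrite /tail_prob e; move: t0; rewrite le_eqVlt => /predU1P[<-|t0].
  rewrite mulr0 expR0 mul1r (_ : [set _ | _] = setT) ?probability_setT//.
  by apply/seteqP; split=> w //= _; rewrite subnn.
rewrite (poisson_increment hN)//= subr0 /poisson_pmf mulr_gt0//.
by rewrite expr0 fact0 divr1 mul1r -expRD subrr expR0.
Qed.

(** Follows [x + c * r = y] from the edge of the cone to the point [(x, t)]. The probability [g] and
    the closed form [psi] both vanish at the start and have the same increments up to telescoping
    errors. *)
Lemma tail_formula_odd k :
  (forall t x : R, 0 <= t -> 0 <= x <= c * t ->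
     expR (lam * t) * F k.*2 x t =
     tail_coef k k * (c * t - x) ^+ k * (c * t + x) ^+ k) ->
  forall t x : R, 0 <= t -> 0 <= x <= c * t ->
     expR (lam * t) * F k.*2.+1 x t =
     tail_coef k.+1 k * (c * t - x) ^+ k.+1 * (c * t + x) ^+ k.
Proof.
move=> IH t x t0 /andP[x0 xct].
(* [y] is constant along the line and [r0] is the time at which the line meets the edge
   [x = c * r]. *)
pose y := x + c * t; pose r0 := y / (2 * c).
have y0 : 0 <= y by rewrite addr_ge0// mulr_ge0// ltW.
have r00 : 0 <= r0 by rewrite divr_ge0// mulr_ge0// ltW.
have yr0 : y = 2 * (c * r0).
  by rewrite /r0; field; rewrite gt_eqF.
have r0t : r0 <= t by rewrite -(ler_pM2l hc); move: yr0; rewrite /y; lra.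
pose psi r := tail_coef k.+1 k * (2 * (c * r) - y) ^+ k.+1 * y ^+ k.
pose phi r := lam * tail_coef k k * y ^+ k * (2 * (c * r) - y) ^+ k.
pose g r := expR (lam * r) * F k.*2.+1 (y - c * r) r.
suff : g t - psi t = g r0 - psi r0.
  have -> : g r0 = 0.
    rewrite /g (_ : y - c * r0 = c * r0); last by rewrite yr0; ring.
    by rewrite tail_prob_boundary ?mulr0//= odd_double.
  have -> : psi r0 = 0.
    by rewrite /psi (_ : 2 * (c * r0) - y = 0) ?expr0n/= ?mulr0 ?mul0r// -yr0 subrr.
  rewrite subr0 => /eqP; rewrite subr_eq0 => /eqP.
  rewrite /g /psi (_ : y - c * t = x); last by rewrite /y; ring.
  move=> ->; congr (_ * _ ^+ _ * _ ^+ _); rewrite /y; ring.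
apply: (@telescoping_cst _ (fun r => g r - psi r) phi r0 t
  (expR (lam * t) * lam ^+ 2)) => // r h r0r h0 rht.
have h0' := ltW h0.
have rr0 : 0 <= r by exact: le_trans r0r.
have crh : c * r + c * h <= c * t by rewrite -mulrDr ler_pM2l.
have ch0 : 0 < c * h by rewrite mulr_gt0.
have ycr : y <= 2 * (c * r) by rewrite yr0 ler_wpM2l// ler_pM2l.
have ytx : y - c * t = x by rewrite /y; ring.
have chx : c * h <= y - c * r by lra.
have := @odd_step _ _ _ P lam c N hlam hc hN k.*2 (y - c * r) r h.
rewrite odd_double/= => /(_ isT rr0 h0 chx).
rewrite (_ : y - c * r - c * h = y - c * (r + h)); last by ring.
have IHL : expR (lam * r) * (lam * h * F k.*2 (y - c * r) r) = h * phi r.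
  rewrite mulrCA IH//; last by apply/andP; split; lra.
  rewrite /phi (_ : c * r - (y - c * r) = 2 * (c * r) - y); last by ring.
  rewrite (_ : c * r + (y - c * r) = y); last by ring.
  by ring.
(* The shifted level may be negative, outside the range of [IH], and is first raised to [0]. In
   either case the two factors of the closed form are at most [2 * (c * (r + h)) - y] and [y], the
   factors in [phi (r + h)]. *)
have IHU : expR (lam * r) * (lam * h * F k.*2 (y - c * r - 2 * (c * h)) r)
    <= h * phi (r + h).
  rewrite mulrCA tail_prob_max//.
  set x1 := Num.max _ 0.
  have x10 : 0 <= x1 by rewrite le_max lexx orbT.
  have x1le : x1 <= y - c * r by rewrite ge_max; apply/andP; split; lra.
  have x1ge : y - c * r - 2 * (c * h) <= x1 by rewrite le_max lexx.
  rewrite IH//; last by apply/andP; split; lra.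
  rewrite /phi [leRHS](_ : _ = lam * h * (tail_coef k k * (2 * (c * (r + h)) - y) ^+ k * y ^+ k)).
    have crx : 0 <= c * r - x1 by lra.
    have crx' : 0 <= c * r + x1 by lra.
    have crh' : c * r - x1 <= 2 * (c * (r + h)) - y by rewrite (mulrDr c); lra.
    have crh'' : c * r + x1 <= y by lra.
    rewrite ler_wpM2l ?mulr_ge0 ?(ltW hlam)//.
    apply: ler_pM; [by apply: mulr_ge0; [exact: tail_coef_ge0|exact: exprn_ge0]
                   |exact: exprn_ge0| |].
      rewrite ler_wpM2l ?tail_coef_ge0// lerXn2r// ?nnegrE//.
      exact: le_trans crh'.
    by rewrite lerXn2r// ?nnegrE.
  by ring.
move=> /andP[].
rewrite !(mulrDr (expR _)) IHL -/(g (r + h)) -/(g r) => lo hi.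
have {}hi : g (r + h) <= g r + h * phi (r + h) + expR (lam * t) * lam ^+ 2 * h ^+ 2.
  apply: (le_trans hi); apply: lerD; first by rewrite lerD2l.
  rewrite exprMn mulrA ler_wpM2r ?exprn_ge0//.
  by rewrite ler_wpM2r ?exprn_ge0 ?(ltW hlam)// ler_expR ler_pM2l.
have /subrX_bounds : 0 <= 2 * (c * r) - y by rewrite subr_ge0.
move=> /(_ k (2 * (c * (r + h)) - y)) => /(_ _)/andP[].
  by rewrite mulrDr; lra.
have K0 : 0 <= tail_coef k.+1 k * y ^+ k by rewrite mulr_ge0 ?exprn_ge0 ?tail_coef_ge0.
have Kc u : tail_coef k.+1 k * y ^+ k * (k.+1%:R * u * (2 * (c * (r + h)) - y - (2 * (c * r) - y)))
    = h * (lam * tail_coef k k * y ^+ k * u).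
  by rewrite -tail_coefS; ring.
move=> /(ler_wpM2l K0) + /(ler_wpM2l K0); rewrite !Kc -/(phi r) -/(phi (r + h)).
have -> : tail_coef k.+1 k * y ^+ k * ((2 * (c * (r + h)) - y) ^+ k.+1 - (2 * (c * r) - y) ^+ k.+1)
  = psi (r + h) - psi r by rewrite /psi; ring.
have e0 : 0 <= expR (lam * t) * lam ^+ 2 * h ^+ 2.
  by rewrite !mulr_ge0 ?exprn_ge0 ?expR_ge0 ?(ltW hlam).
move: lo hi e0; rewrite ler_norml.
move: (g _) (g _) (psi _) (psi _) (phi _) (phi _) (expR _ * _ * _) => g1 g2 p1 p2 f1 f2 e.
move=> *; apply/andP; split; lra.
Qed.

Section EvenCase.
Variable k : nat.
Hypothesis IH : forall t x : R, 0 <= t -> 0 <= x <= c * t ->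
  expR (lam * t) * F k.*2.+1 x t =
  tail_coef k.+1 k * (c * t - x) ^+ k.+1 * (c * t + x) ^+ k.

Lemma tail_odd_lower (t x u : R) : 0 <= t -> 0 <= x <= c * t -> 0 <= u ->
  tail_coef k.+1 k * ((c * t - x) ^+ k.+1 - k.+1%:R * (c * t - x) ^+ k * u)
    * (c * t + x) ^+ k
  <= expR (lam * t) * F k.*2.+1 (x + u) t.
Proof.
move=> t0 /andP[x0 xct] u0.
have a0 : 0 <= c * t - x by rewrite subr_ge0.
have b0 : 0 <= c * t + x by rewrite addr_ge0// (le_trans x0).
have K0 := tail_coef_ge0 k.+1 k.
have [xu|xu] := leP (x + u) (c * t).
  rewrite IH//; last by rewrite xu addr_ge0.
  have a1 : 0 <= c * t - (x + u) by rewrite subr_ge0.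
  have ale : c * t - (x + u) <= c * t - x by lra.
  have /andP[_] := subrX_bounds k a1 ale.
  have -> : c * t - x - (c * t - (x + u)) = u by ring.
  set A := (c * t - (x + u)) ^+ k.+1 => H.
  have A0 : 0 <= A by exact: exprn_ge0.
  apply: (@le_trans _ _ (tail_coef k.+1 k * A * (c * t + x) ^+ k)).
    rewrite ler_wpM2r ?exprn_ge0// ler_wpM2l//; lra.
  apply: ler_wpM2l; first exact: mulr_ge0.
  by rewrite lerXn2r// ?nnegrE; lra.
(* Beyond the cone [c * t - x < u], so the linearized expression is nonpositive and nonnegativity of
   the probability suffices. *)
apply: (@le_trans _ _ 0); last by rewrite mulr_ge0 ?expR_ge0 ?tail_prob_ge0.
rewrite mulr_le0_ge0 ?exprn_ge0// mulr_ge0_le0// exprS subr_le0.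
rewrite mulrC mulrAC [leRHS]mulrC ler_pM ?exprn_ge0//.
  rewrite (le_trans (ltW _) (ler_peMl u0 _)) ?ler1n//; lra.
Qed.

(** Initial values for the even characteristics, found along the barrier itself: [even_step] started
    from level [- (c * h)] ends at level [0], and the levels [- (c * h)] and [0] define the same
    event. *)
Lemma tail_formula_even0 t : 0 <= t ->
  expR (lam * t) * F k.+1.*2 0 t =
  tail_coef k.+1 k.+1 * (c * t) ^+ k.+1 * (c * t) ^+ k.+1.
Proof.
move=> t0; pose A r := tail_coef k.+1 k * (c * r) ^+ k.*2.+1.
pose psi r := tail_coef k.+1 k.+1 * (c * r) ^+ k.*2.+2.
pose phi r := lam * A r.
pose g r := expR (lam * r) * F k.*2.+2 0 r.
suff : g t - psi t = g 0 - psi 0.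
  rewrite /g tail_prob_time0// mulr0 /psi mulr0 expr0n/= mulr0 subrr.
  move/eqP; rewrite subr_eq0 doubleS => /eqP ->.
  by rewrite -mulrA -exprD addSn addnS addnn.
(* [C1 * h] bounds, uniformly for [r <= t], the loss in [tail_odd_lower] caused by raising the level
   by [2 * (c * h)]. *)
pose C1 := tail_coef k.+1 k * (k.+1%:R * (c * t) ^+ k * (2 * c)) * (c * t) ^+ k.
apply: (@telescoping_cst _ (fun r => g r - psi r) phi 0 t
  (lam * C1 + expR (lam * t) * lam ^+ 2)) => // r h r0 h0 rht.
have h0' := ltW h0.
have ch0 : 0 < c * h by rewrite mulr_gt0.
have lh0 : 0 <= lam * h by rewrite mulr_ge0// ltW.
have cr0 : 0 <= c * r by rewrite mulr_ge0// ltW.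
have crt : c * r <= c * t by rewrite ler_pM2l//; lra.
have crI : 0 <= (0 : R) <= c * r by apply/andP.
have := @even_step _ _ _ P lam c N hlam hc hN k.*2.+1 (- (c * h)) r h.
rewrite /= odd_double/= => /(_ isT r0 h0).
rewrite addNr !(tail_prob_max _ (- (c * h)))// (_ : Num.max (- _) 0 = 0); last first.
  by rewrite max_r// oppr_le0 ltW.
rewrite !(mulrDr (expR _)) -/(g (r + h)) -/(g r).
have -> : expR (lam * r) * (lam * h * F k.*2.+1 0 r) = h * phi r.
  rewrite mulrCA IH// subr0 addr0 /phi /A -mulrA -exprD addSn addnn; ring.
have := tail_odd_lower r0 crI (ltW (mulr_gt0 (@ltr0n R 2) ch0)).
rewrite subr0 addr0 => lo0.
have {}lo0 : h * phi r - lam * C1 * h ^+ 2 <=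
    expR (lam * r) * (lam * h * F k.*2.+1 (0 + 2 * (c * h)) r).
  rewrite [leRHS]mulrCA; apply: (le_trans _ (ler_wpM2l lh0 lo0)).
  have -> : h * phi r = lam * h * (tail_coef k.+1 k * (c * r) ^+ k.+1 * (c * r) ^+ k).
    rewrite /phi /A -(mulrA (tail_coef _ _)) -exprD addSn addnn; ring.
  have -> : lam * C1 * h ^+ 2 = lam * h * (C1 * h) by ring.
  rewrite -mulrBr ler_wpM2l ?mulr_ge0 ?(ltW hlam)//.
  rewrite mulrBr mulrBl lerD2l lerN2 /C1.
  rewrite [leLHS](_ : _ = tail_coef k.+1 k * (k.+1%:R * (2 * c)) * h * ((c * r) ^+ k * (c * r) ^+ k)); last by ring.
  rewrite [leRHS](_ : _ = tail_coef k.+1 k * (k.+1%:R * (2 * c)) * h * ((c * t) ^+ k * (c * t) ^+ k)); last by ring.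
  rewrite ler_wpM2l//.
    by rewrite mulr_ge0// mulr_ge0 ?tail_coef_ge0// !mulr_ge0// ltW.
  have ct0 : 0 <= c * t by exact: le_trans crt.
  have le : (c * r) ^+ k <= (c * t) ^+ k by rewrite lerXn2r.
  by rewrite ler_pM ?exprn_ge0.
move=> /andP[lo hi].
have {}lo : g r + h * phi r - lam * C1 * h ^+ 2 <= g (r + h).
  by apply: le_trans lo; rewrite -addrA lerD2l.
have {}hi : g (r + h) <= g r + h * phi r + expR (lam * t) * lam ^+ 2 * h ^+ 2.
  apply: (le_trans hi); rewrite lerD2l.
  rewrite exprMn mulrA ler_wpM2r ?exprn_ge0//.
  by rewrite ler_wpM2r ?exprn_ge0 ?(ltW hlam)// ler_expR ler_pM2l.
have crh : c * r <= c * (r + h) by rewrite mulrDr lerDl ltW.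
have K0 := tail_coef_ge0 k.+1 k.+1.
have Kc u : tail_coef k.+1 k.+1 * (k.*2.+2%:R * u * (c * (r + h) - c * r))
    = h * (lam * (tail_coef k.+1 k * u)).
  rewrite [RHS](_ : _ = h * u * (lam * tail_coef k.+1 k)); last by ring.
  rewrite (tail_coefC k.+1 k) -tail_coefS -doubleS -muln2 natrM; ring.
have /andP[] := subrX_bounds k.*2.+1 cr0 crh.
move=> /(ler_wpM2l K0) + /(ler_wpM2l K0); rewrite !Kc -/(A r) -/(A (r + h)) -/(phi r) -/(phi (r + h)).
rewrite mulrBr -/(psi r) -/(psi (r + h)).
have e0 : 0 <= expR (lam * t) * lam ^+ 2 * h ^+ 2.
  by rewrite !mulr_ge0 ?exprn_ge0 ?expR_ge0 ?(ltW hlam).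
have C0 : 0 <= lam * C1 * h ^+ 2.
  have ct0 : 0 <= c * t by exact: le_trans crt.
  rewrite /C1 mulr_ge0 ?exprn_ge0// mulr_ge0 ?(ltW hlam)//.
  by rewrite mulr_ge0 ?exprn_ge0// mulr_ge0 ?tail_coef_ge0// !mulr_ge0 ?exprn_ge0// ltW.
move: lo hi e0 C0; rewrite ler_norml (mulrDl _ _ (h ^+ 2)).
move: (g _) (g _) (psi _) (psi _) (phi _) (phi _) (expR _ * _ * _) (_ * h ^+ 2) => g1 g2 p1 p2 f1 f2 e e'.
move=> *; apply/andP; split; lra.
Qed.

(** Follows the line on which [c * r] minus the position keeps the value [a = c * t - x]; it leaves
    the barrier at time [r0], where [tail_formula_even0] applies. *)
Lemma tail_formula_even t x : 0 <= t -> 0 <= x <= c * t ->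
  expR (lam * t) * F k.+1.*2 x t =
  tail_coef k.+1 k.+1 * (c * t - x) ^+ k.+1 * (c * t + x) ^+ k.+1.
Proof.
move=> t0 /andP[x0 xct]; pose r0 := t - x / c.
have cr0 : c * r0 = c * t - x by rewrite /r0 mulrBr mulrCA divff ?mulr1// gt_eqF.
have r00 : 0 <= r0 by rewrite -(pmulr_rge0 _ hc) cr0 subr_ge0.
have r0t : r0 <= t by rewrite -(ler_pM2l hc) cr0 lerBlDr lerDl.
pose a := c * t - x.
have a0 : 0 <= a by rewrite subr_ge0.
pose A r := tail_coef k.+1 k * a ^+ k.+1 * (2 * (c * r) - a) ^+ k.
pose psi r := tail_coef k.+1 k.+1 * a ^+ k.+1 * (2 * (c * r) - a) ^+ k.+1.
pose phi r := lam * A r.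
pose g r := expR (lam * r) * F k.*2.+2 (c * r - a) r.
suff : g t - psi t = g r0 - psi r0.
  rewrite {2}/g -doubleS (_ : c * r0 - a = 0); last by rewrite cr0 subrr.
  rewrite tail_formula_even0// {2}/psi cr0 -/a (_ : 2 * a - a = a) ?subrr; last by ring.
  move/eqP; rewrite subr_eq0 /g /psi => /eqP.
  rewrite (_ : c * t - a = x); last by rewrite /a; ring.
  move=> ->; congr (_ * _ ^+ _); rewrite /a; ring.
pose C1 := tail_coef k.+1 k * (k.+1%:R * a ^+ k * (2 * c)) * (c * t + x) ^+ k.
apply: (@telescoping_cst _ (fun r => g r - psi r) phi r0 t
  (lam * C1 + expR (lam * t) * lam ^+ 2)) => // r h r0r h0 rht.
have h0' := ltW h0.
have ch0 : 0 < c * h by rewrite mulr_gt0.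
have lh0 : 0 <= lam * h by rewrite mulr_ge0// ltW.
have rr0 : 0 <= r by exact: le_trans r0r.
have cra : a <= c * r by rewrite /a -cr0 ler_pM2l.
have cr00 : 0 <= c * r by exact: le_trans cra.
have crht : c * r + c * h <= c * t by rewrite -mulrDr ler_pM2l.
have crI : 0 <= c * r - a <= c * r by rewrite subr_ge0 cra lerBlDr lerDl.
have := @even_step _ _ _ P lam c N hlam hc hN k.*2.+1 (c * r - a) r h.
rewrite /= odd_double/= => /(_ isT rr0 h0).
rewrite (_ : c * r - a + c * h = c * (r + h) - a); last by ring.
rewrite (_ : Num.max (c * r - a) 0 = c * r - a); last by rewrite max_l// subr_ge0.
rewrite !(mulrDr (expR _)) -/(g (r + h)) -/(g r).
have cra1 : c * r - (c * r - a) = a by ring.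
have cra2 : c * r + (c * r - a) = 2 * (c * r) - a by ring.
have -> : expR (lam * r) * (lam * h * F k.*2.+1 (c * r - a) r) = h * phi r.
  rewrite mulrCA IH// cra1 cra2 /phi /A; ring.
have := tail_odd_lower rr0 crI (ltW (mulr_gt0 (@ltr0n R 2) ch0)).
rewrite cra1 cra2 => lo0.
have {}lo0 : h * phi r - lam * C1 * h ^+ 2 <=
    expR (lam * r) * (lam * h * F k.*2.+1 (c * r - a + 2 * (c * h)) r).
  rewrite [leRHS]mulrCA; apply: (le_trans _ (ler_wpM2l lh0 lo0)).
  have -> : h * phi r = lam * h * (tail_coef k.+1 k * a ^+ k.+1 * (2 * (c * r) - a) ^+ k).
    rewrite /phi /A; ring.
  have -> : lam * C1 * h ^+ 2 = lam * h * (C1 * h) by ring.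
  rewrite -mulrBr ler_wpM2l ?mulr_ge0 ?(ltW hlam)//.
  rewrite mulrBr mulrBl lerD2l lerN2 /C1.
  rewrite [leLHS](_ : _ = tail_coef k.+1 k * (k.+1%:R * (2 * c)) * h * (a ^+ k * (2 * (c * r) - a) ^+ k)); last by ring.
  rewrite [leRHS](_ : _ = tail_coef k.+1 k * (k.+1%:R * (2 * c)) * h * (a ^+ k * (c * t + x) ^+ k)); last by ring.
  rewrite ler_wpM2l//.
    by rewrite mulr_ge0// mulr_ge0 ?tail_coef_ge0// !mulr_ge0// ltW.
  have le : (2 * (c * r) - a) ^+ k <= (c * t + x) ^+ k.
    have b0 : 0 <= 2 * (c * r) - a by lra.
    have bct : 2 * (c * r) - a <= c * t + x.
      by move: crht; rewrite /a; lra.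
    by rewrite lerXn2r// nnegrE// (le_trans b0).
  by rewrite ler_wpM2l ?exprn_ge0.
move=> /andP[lo hi].
have {}lo : g r + h * phi r - lam * C1 * h ^+ 2 <= g (r + h).
  by apply: le_trans lo; rewrite -addrA lerD2l.
have {}hi : g (r + h) <= g r + h * phi r + expR (lam * t) * lam ^+ 2 * h ^+ 2.
  apply: (le_trans hi); rewrite lerD2l.
  rewrite exprMn mulrA ler_wpM2r ?exprn_ge0//.
  by rewrite ler_wpM2r ?exprn_ge0 ?(ltW hlam)// ler_expR ler_pM2l.
have b0 : 0 <= 2 * (c * r) - a by lra.
have bh : 2 * (c * r) - a <= 2 * (c * (r + h)) - a by rewrite (mulrDr c); lra.
have K0 : 0 <= tail_coef k.+1 k.+1 * a ^+ k.+1 by rewrite mulr_ge0 ?exprn_ge0 ?tail_coef_ge0.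
have Kc u : tail_coef k.+1 k.+1 * a ^+ k.+1 * (k.+1%:R * u * (2 * (c * (r + h)) - a - (2 * (c * r) - a)))
    = h * (lam * (tail_coef k.+1 k * a ^+ k.+1 * u)).
  rewrite [RHS](_ : _ = h * u * a ^+ k.+1 * (lam * tail_coef k.+1 k)); last by ring.
  rewrite (tail_coefC k.+1 k) -tail_coefS; ring.
have /andP[] := subrX_bounds k b0 bh.
move=> /(ler_wpM2l K0) + /(ler_wpM2l K0); rewrite !Kc -/(A r) -/(A (r + h)) -/(phi r) -/(phi (r + h)).
rewrite mulrBr -/(psi r) -/(psi (r + h)).
have e0 : 0 <= expR (lam * t) * lam ^+ 2 * h ^+ 2.
  by rewrite !mulr_ge0 ?exprn_ge0 ?expR_ge0 ?(ltW hlam).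
have C0 : 0 <= lam * C1 * h ^+ 2.
  have ct0 : 0 <= c * t + x by rewrite addr_ge0// (le_trans x0).
  rewrite /C1 mulr_ge0 ?exprn_ge0// mulr_ge0 ?(ltW hlam)//.
  by rewrite mulr_ge0 ?exprn_ge0// mulr_ge0 ?tail_coef_ge0// !mulr_ge0 ?exprn_ge0// ltW.
move: lo hi e0 C0; rewrite ler_norml (mulrDl _ _ (h ^+ 2)).
move: (g _) (g _) (psi _) (psi _) (phi _) (phi _) (expR _ * _ * _) (_ * h ^+ 2) => g1 g2 p1 p2 f1 f2 e e'.
move=> *; apply/andP; split; lra.
Qed.

End EvenCase.

Lemma tail_formula n t x : 0 <= t -> 0 <= x <= c * t ->
  expR (lam * t) * F n x t =
  tail_coef (uphalf n) n./2 * (c * t - x) ^+ uphalf n * (c * t + x) ^+ n./2.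
Proof.
have H k : (forall t x : R, 0 <= t -> 0 <= x <= c * t -> expR (lam * t) * F k.*2 x t =
     tail_coef k k * (c * t - x) ^+ k * (c * t + x) ^+ k).
  elim: k => [|k IH] {}t {}x t0 xI.
    by rewrite tail_prob_base// /tail_coef !expr0 fact0 !mulr1 divr1.
  by apply: tail_formula_even => //; exact: tail_formula_odd.
move=> t0 xI; rewrite -(odd_double_half n); move: (odd n) n./2 => b {}n.
case: b; rewrite ?add1n ?add0n uphalf_half /= ?uphalf_double ?doubleK ?odd_double/=.
  by rewrite add1n; apply: tail_formula_odd => //; exact: H.
by rewrite add0n; exact: H.
Qed.

End SurvivalFormula.

(** * Bessel functions *)

Section PointwiseDerivatives.
Context {R : realType}.
Implicit Types (f g : R -> R) (x a b : R).

Lemma is_derive_cstf x a : is_derive x 1 (fun=> a) 0.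
Proof. exact: is_derive_cst. Qed.

Lemma is_derive_idf x : is_derive x 1 (fun y : R => y) 1.
Proof. exact: is_derive_id. Qed.

Lemma is_derive_addf f g x a b : is_derive x 1 f a -> is_derive x 1 g b ->
  is_derive x 1 (fun y => f y + g y) (a + b).
Proof. by move=> fa gb; exact: (is_deriveD fa gb). Qed.

Lemma is_derive_oppf f x a : is_derive x 1 f a -> is_derive x 1 (fun y => - f y) (- a).
Proof. by move=> fa; exact: (is_deriveN fa). Qed.

Lemma is_derive_mulf f g x a b : is_derive x 1 f a -> is_derive x 1 g b ->
  is_derive x 1 (fun y => f y * g y) (a * g x + f x * b).
Proof.
move=> fa gb; apply: is_derive_eq (is_deriveM fa gb) _.
by rewrite /GRing.scale/= addrC (mulrC a).
Qed.

Lemma is_derive_scalef f x a b : is_derive x 1 f a ->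
  is_derive x 1 (fun y => b * f y) (b * a).
Proof.
move=> fa; apply: is_derive_eq (is_derive_mulf (is_derive_cstf x b) fa) _.
by rewrite mul0r add0r.
Qed.

Lemma is_derive_exprf n x : is_derive x 1 (fun y : R => y ^+ n.+1) (n.+1%:R * x ^+ n).
Proof.
elim: n => [|n IH].
  by rewrite expr0 mulr1; exact: is_derive_id.
under [X in is_derive _ _ X]eq_fun do rewrite exprS.
apply: is_derive_eq (is_derive_mulf (is_derive_idf x) IH) _.
by rewrite -(natr1 n.+1) (exprS _ n); ring.
Qed.

Lemma is_derive_compf f g x a b : is_derive (g x) 1 f a -> is_derive x 1 g b ->
  is_derive x 1 (fun y => f (g y)) (a * b).
Proof. exact: is_derive1_comp. Qed.

Lemma is_derive_invf f x a : f x != 0 -> is_derive x 1 f a ->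
  is_derive x 1 (fun y => (f y)^-1) (- a / f x ^+ 2).
Proof.
move=> fx fa; apply: is_derive_eq (is_deriveV fx fa) _.
by rewrite /GRing.scale/= mulrC mulNr mulrN -exprVn.
Qed.

End PointwiseDerivatives.

Section GammaFactorial.
Context {R : realType}.

(* An antiderivative of [x ^+ n * expR (- x)], obtained by repeated integration by parts. *)
Fixpoint gamma_primitive (n : nat) (x : R) : R :=
  if n is m.+1 then - (x ^+ m.+1 * expR (- x)) + m.+1%:R * gamma_primitive m x
  else - expR (- x).

Lemma is_derive_expRN (x : R) : is_derive x 1 (fun y : R => expR (- y)) (- expR (- x)).
Proof.
apply: is_derive_eq (is_derive_compf (is_derive_expR (- x)) (is_derive_oppf (is_derive_idf x))) _.
by rewrite mulrN1.
Qed.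

Lemma is_derive_gamma_primitive n (x : R) :
  is_derive x 1 (gamma_primitive n) (x ^+ n * expR (- x)).
Proof.
have e := is_derive_expRN x.
elim: n => [|n IH] /=.
  by apply: is_derive_eq (is_derive_oppf e) _; rewrite opprK expr0 mul1r.
apply: is_derive_eq (is_derive_addf (is_derive_oppf (is_derive_mulf (is_derive_exprf n x) e))
  (is_derive_scalef n.+1%:R IH)) _.
ring.
Qed.

(** Since [expR x >= x ^+ n.+1 / n.+1!], the product is at most [n.+1! / x]. *)
Lemma cvg_exprMexpRN n : (x : R) ^+ n * expR (- x) @[x --> +oo] --> 0.
Proof.
apply/cvgrPdist_le => e e0; near=> x.
have x0 : 0 < x by near: x; exact: nbhs_pinfty_gt.
rewrite sub0r normrN ger0_norm; last by rewrite mulr_ge0 ?expR_ge0 ?exprn_ge0 ?ltW.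
have := expR_ge1Dxn n (ltW x0).
rewrite expRN -ler_pdivlMr ?invr_gt0 ?expR_gt0// invrK => H.
apply: (@le_trans _ _ (e * (x ^+ n.+1 / n.+1`!%:R))).
  rewrite exprS; rewrite [leRHS](_ : _ = x ^+ n * (x * (e / n.+1`!%:R))); last by ring.
  rewrite ler_peMr ?exprn_ge0 ?(ltW x0)// -ler_pdivrMr ?divr_gt0 ?ltr0n ?fact_gt0//.
by rewrite ler_pM2l// (le_trans _ H)// lerDr.
Unshelve. all: end_near. Qed.

Lemma cvg_gamma_primitive n : gamma_primitive n x @[x --> +oo] --> 0.
Proof.
elim: n => [|n IH] /=.
  by rewrite -[X in _ --> X]oppr0; apply: cvgN; exact: cvgr_expR.
have -> : 0 = - 0 + n.+1%:R * 0 :> R by rewrite mulr0 oppr0 addr0.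
apply: cvgD; first by apply: cvgN; exact: (cvg_exprMexpRN n.+1).
by apply: cvgM => //; exact: cvg_cst.
Qed.

Lemma gamma_primitive0 n : gamma_primitive n 0 = - n`!%:R.
Proof.
elim: n => [|n IH] /=; first by rewrite oppr0 expR0.
by rewrite IH expr0n/= mul0r oppr0 add0r mulrN -natrM factS.
Qed.

Lemma Gamma_nat n : Gamma (n.+1%:R : R) = n`!%:R.
Proof.
pose f (x : R) := x ^+ n * expR (- x).
have cf : continuous f.
  move=> x; apply: cvgM; first exact: exprn_continuous.
  by apply: (@continuous_comp _ _ _ (-%R) expR); [exact: oppr_continuous|exact: continuous_expR].
have dF x := is_derive_gamma_primitive n x.
have := @ge0_continuous_FTC2y R f (gamma_primitive n) 0 0.
rewrite gamma_primitive0 sub0e -EFinN opprK => H.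
have {}H : (\int[lebesgue_measure]_(x in `[0%R, +oo[) (f x)%:E = n`!%:R%:E)%E.
  apply: H.
  - by move=> x x0; rewrite mulr_ge0 ?exprn_ge0 ?expR_ge0.
  - exact: continuous_subspaceT.
  - exact: cvg_gamma_primitive.
  - by move=> x _; case: (dF x).
  - rewrite -gamma_primitive0; apply: cvg_at_right_filter.
    by apply/differentiable_continuous/derivable1_diffP; case: (dF 0).
  - by move=> x _; rewrite derive1E; case: (dF x).
rewrite /Gamma /Rintegral -[RHS]/(fine n`!%:R%:E) -H; congr fine.
rewrite -integral_itv_obnd_cbnd; last first.
  apply/measurable_EFinP; apply: measurable_funTS. exact: continuous_measurable_fun.
apply: eq_integral => x; rewrite inE/= in_itv/= andbT => x0.
by rewrite -natr1 addrK powR_mulrn// ltW.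
Qed.

End GammaFactorial.

(** * Bessel-Clifford functions: entire, hence free of square roots and regular at the edge of the
    cone *)

Section BesselClifford.
Context {R : realType}.
Implicit Types (z : R) (j : nat).

Definition clifford_coef j (k : nat) : R := (k`!%:R * (k + j)`!%:R)^-1.

(* [clifford j z] is [z^(-j/2) I_j(2 sqrt z)]. *)
Definition clifford j z : R := limn (pseries (clifford_coef j) z).

(** Termwise differentiation cancels [k.+1] against [k.+1!] and only raises the index, so all
    derivatives stay in the family. *)
Lemma clifford_diffs j : pseries_diffs (clifford_coef j) = clifford_coef j.+1.
Proof.
apply/funext => k; rewrite /pseries_diffs /clifford_coef factS natrM addSnnS.
by field; rewrite addrC natr1 !pnatr_eq0 -!lt0n !fact_gt0.
Qed.

Lemma is_cvg_clifford_ge0 j z : 0 <= z -> cvgn (pseries (clifford_coef j) z).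
Proof.
move=> z0; apply: series_le_cvg (is_cvg_series_exp_coeff z) => k /=.
- by rewrite mulr_ge0 ?exprn_ge0// invr_ge0 mulr_ge0.
- by rewrite /exp_coeff/= divr_ge0 ?exprn_ge0.
rewrite /exp_coeff/= mulrC ler_wpM2l ?exprn_ge0// lef_pV2 ?posrE ?mulr_gt0 ?ltr0n ?fact_gt0//.
by rewrite ler_peMr// ler1n fact_gt0.
Qed.

Lemma is_cvg_clifford j z : cvgn (pseries (clifford_coef j) z).
Proof.
apply: (@is_cvg_pseries_inside _ _ (`|z| + 1)).
  by apply: is_cvg_clifford_ge0; rewrite addr_ge0.
by rewrite [ltRHS]ger0_norm ?addr_ge0// ltrDl.
Qed.

Lemma is_derive_clifford j z : is_derive z 1 (clifford j) (clifford j.+1 z).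
Proof.
rewrite /clifford -clifford_diffs; apply: (@pseries_snd_diffs _ _ (`|z| + 1)).
- exact: is_cvg_clifford.
- by rewrite clifford_diffs; exact: is_cvg_clifford.
- by rewrite !clifford_diffs; exact: is_cvg_clifford.
- by rewrite [ltRHS]ger0_norm ?addr_ge0// ltrDl.
Qed.

(** The three-term recurrence of the functions [I_j], from [k + j + 1 = (j + 1) + k] on
    coefficients. As differentiation raises the index, it is also the equation
    [z y'' + (j + 1) y' = y] for [y = clifford j]. *)
Lemma clifford_rec j z :
  clifford j z = j.+1%:R * clifford j.+1 z + z * clifford j.+2 z.
Proof.
have cv j' := @is_cvg_clifford j' z.
apply/cvg_lim => //; rewrite -(cvg_shiftS (pseries _ _)).
have -> : [sequence pseries (clifford_coef j) z n.+1]_n =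
  (fun n => j.+1%:R * pseries (clifford_coef j.+1) z n.+1
            + z * pseries (clifford_coef j.+2) z n).
  apply/funext => n; rewrite /pseries/= /series/= !big_nat_recl//.
  rewrite mulrDr -addrA; congr (_ + _).
    by rewrite /clifford_coef !add0n factS natrM expr0; field; rewrite addrC natr1 !pnatr_eq0 -lt0n fact_gt0.
  rewrite !mulr_sumr -big_split; apply: eq_bigr => i _ /=.
  rewrite /clifford_coef !addSn !addnS !factS !natrM exprS.
  by field; rewrite -!natrD !nat1r !pnatr_eq0 -!lt0n !fact_gt0.
have cv1 : pseries (clifford_coef j.+1) z n.+1 @[n --> \oo] --> clifford j.+1 z.
  by rewrite (cvg_shiftS (pseries _ _)); exact: cv.
exact: cvgD (cvgM (cvg_cst _) cv1) (cvgM (cvg_cst _) (cv j.+2)).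
Qed.

Lemma clifford_gt0 j z : 0 <= z -> 0 < clifford j z.
Proof.
move=> z0; have c0 : 0 < clifford_coef j 0 by rewrite invr_gt0 mulr_gt0 ?ltr0n ?fact_gt0.
apply: (lt_le_trans c0); apply: limr_ge; first exact: is_cvg_clifford.
near=> n; rewrite /pseries /series/=.
have -> : n = n.-1.+1 by rewrite prednK//; near: n; exists 1%N.
rewrite big_nat_recl// expr0 mulr1 lerDl sumr_ge0// => i _.
by rewrite mulr_ge0 ?exprn_ge0// invr_ge0 mulr_ge0.
Unshelve. all: end_near. Qed.

Lemma besselI_clifford (j : nat) (x : R) : 0 < x ->
  besselI j%:R x = (x / 2) ^+ j * clifford j ((x / 2) ^+ 2).
Proof.
move=> x0; rewrite /besselI.
have x20 : 0 <= x / 2 by rewrite divr_ge0// ltW.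
apply/cvg_lim => //.
have -> : series (fun k : nat => (x / 2) `^ ((2 * k)%:R + j%:R) / (k`!%:R * Gamma (j%:R + k%:R + 1)))
   = (fun n => (x / 2) ^+ j * pseries (clifford_coef j) ((x / 2) ^+ 2) n).
  apply/funext => n; rewrite /pseries /series/= mulr_sumr; apply: eq_bigr => k _.
  rewrite -!natrD natr1 Gamma_nat powR_mulrn// exprD exprM /clifford_coef (addnC k).
  ring.
apply: cvgM; [exact: cvg_cst|exact: is_cvg_clifford].
Qed.

End BesselClifford.

(** * Densities from the masses of rays *)

Section DensityMeasure.
Context {R : realType}.
Local Notation mu := (@lebesgue_measure R).
Variable f : R -> \bar R.
Hypothesis f_ge0 : forall x, (0 <= f x)%E.
Hypothesis mf : measurable_fun [set: R] f.

(** Takes the proofs as arguments so that the measure structure, which depends on them, can be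
    attached to it. *)
Definition density_measure of (forall x, (0 <= f x)%E) & measurable_fun [set: R] f :=
  fun A : set R => (\int[mu]_(x in A) f x)%E.

Let dm := density_measure f_ge0 mf.

Let dm0 : dm set0 = 0%E.
Proof. exact: integral_set0. Qed.

Let dm_ge0 A : (0 <= dm A)%E.
Proof. by apply: integral_ge0. Qed.

Let dm_sigma_additive : semi_sigma_additive dm.
Proof.
move=> /= F mF tF mUF; rewrite /dm /density_measure; apply: cvg_toP.
  apply: ereal_nondecreasing_is_cvgn => m n mn.
  by apply: lee_sum_nneg_natr => // k _ _; apply: integral_ge0.
by rewrite ge0_integral_bigcup//=; exact: measurable_funTS.
Qed.

HB.instance Definition _ := isMeasure.Build _ _ _ dm dm0 dm_ge0 dm_sigma_additive.

Definition density_measureT : {measure set R -> \bar R} := dm.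

End DensityMeasure.

Section Density.
Context {R : realType}.
Local Notation mu := (@lebesgue_measure R).

(** If [f x > h x], two levels [m1 < m2] strictly between these values separate [h] from [f] on a
    small interval around [x], and the integrals over it contradict the assumption. *)
Lemma continuous_le_of_integral (f h : R -> R) (x b : R) :
  measurable_fun [set: R] f -> measurable_fun [set: R] h ->
  (forall y, 0 <= y < b -> 0 <= h y) -> 0 < x < b ->
  {for x, continuous f} -> {for x, continuous h} ->
  (forall u v : R, 0 < u -> u < v -> v < b ->
    (\int[mu]_(y in `]u, v[) (f y)%:E <= \int[mu]_(y in `]u, v[) (h y)%:E)%E) ->
  f x <= h x.
Proof.
move=> mf mh h0 /andP[x0 xb] cf ch fh; rewrite leNgt; apply/negP => hf.
pose m1 := (2 * h x + f x) / 3; pose m2 := (h x + 2 * f x) / 3.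
have hm1 : h x < m1 by rewrite /m1; lra.
have m12 : m1 < m2 by rewrite /m1 /m2; lra.
have m2f : m2 < f x by rewrite /m2; lra.
have hx0 : 0 <= h x by apply: h0; rewrite xb ltW.
have : \forall y \near x, [/\ m2 < f y, h y < m1 & 0 < y < b].
  near=> y; split.
  - by near: y; exact: (cvgr_gt (f x)).
  - by near: y; exact: (cvgr_lt (h x)).
  - by apply/andP; split; near: y; [exact: lt_nbhsr|exact: lt_nbhsl].
move=> /nbhs_ballP[e /= e0 He].
pose u := x - e / 2; pose v := x + e / 2.
have xe y : u <= y <= v -> [/\ m2 < f y, h y < m1 & 0 < y < b].
  move=> /andP[uy yv]; apply: He; rewrite /ball/= /u /v in uy yv *.
  by rewrite ltr_norml; apply/andP; split; lra.
have uv : u < v by rewrite /u /v; lra.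
have [_ _ /andP[u0 _]] : [/\ m2 < f u, h u < m1 & 0 < u < b] by apply: xe; rewrite lexx ltW.
have [_ _ /andP[_ vb]] : [/\ m2 < f v, h v < m1 & 0 < v < b] by apply: xe; rewrite lexx ltW.
have := fh u v u0 uv vb; apply/negP; rewrite -ltNge.
have muI : mu `]u, v[ = (v - u)%:E by rewrite lebesgue_measure_itv/= lte_fin uv.
apply: (@le_lt_trans _ _ (\int[mu]_(y in `]u, v[) (cst m1%:E y))%E).
  apply: ge0_le_integral => //.
  - by move=> y /=; rewrite in_itv/= lee_fin => /andP[uy yv]; apply: h0; rewrite !ltW ?(lt_trans u0)// (lt_trans yv).
  - exact/measurable_EFinP/measurable_funTS.
  move=> y /=; rewrite in_itv/= => /andP[uy yv].
  by rewrite lee_fin ltW//; have [] : [/\ m2 < f y, h y < m1 & 0 < y < b] by apply: xe; rewrite !ltW.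
apply: (@lt_le_trans _ _ (\int[mu]_(y in `]u, v[) (cst m2%:E y))%E).
  by rewrite !integral_cst//= muI -!EFinM lte_fin ltr_pM2r// subr_gt0.
have m20 : 0 <= m2 by lra.
apply: ge0_le_integral => //.
  exact/measurable_EFinP/measurable_funTS.
move=> y /=; rewrite in_itv/= => /andP[uy yv].
by rewrite lee_fin ltW//; have [] : [/\ m2 < f y, h y < m1 & 0 < y < b] by apply: xe; rewrite !ltW.
Unshelve. all: end_near. Qed.

Variables (b : R) (g G : R -> R).
Hypotheses (b0 : 0 < b) (cg : continuous g) (g0 : forall y, 0 <= y < b -> 0 <= g y).
Hypothesis dG : forall y : R, is_derive y 1 G (- g y).

Let D : set R := `[0, b[%classic.

Let mg : measurable_fun [set: R] g.
Proof. exact: continuous_measurable_fun. Qed.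

Let gD : R -> \bar R := (EFin \o g) \_ D.

Let gD_ge0 x : (0 <= gD x)%E.
Proof.
rewrite /gD patchE; case: ifPn => //; rewrite inE /D/= in_itv/= => xD.
by rewrite lee_fin g0.
Qed.

Let mgD : measurable_fun [set: R] gD.
Proof.
apply/(measurable_restrictT _ _).1; first exact: measurable_itv.
exact/measurable_EFinP/measurable_funTS.
Qed.

Lemma integral_primitive (a : R) : 0 <= a -> a < b ->
  (\int[mu]_(x in `[a, b[) (g x)%:E = (G a - G b)%:E)%E.
Proof.
move=> a0 ab.
have cG : continuous G by move=> y; apply/differentiable_continuous/derivable1_diffP; case: (dG y).
have dNG (y : R) : is_derive y 1 (fun z : R => - G z) (g y).
  by have := is_derive_oppf (dG y); rewrite opprK.
rewrite integral_itv_bndo_bndc; last exact/measurable_EFinP/measurable_funTS.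
rewrite (@continuous_FTC2 _ g (fun z => - G z))//.
- by rewrite -EFinB opprK addrC.
- exact: continuous_subspaceT.
- split.
  + by move=> y _; case: (dNG y).
  + by apply: cvg_at_right_filter; apply: cvgN; exact: cG.
  + by apply: cvg_at_left_filter; apply: cvgN; exact: cG.
- by move=> y _; rewrite derive1E; case: (dNG y).
Qed.

Variable m : {measure set R -> \bar R}.
Hypothesis mG : forall a : R, 0 <= a <= b -> m `[a, +oo[%classic = (G a)%:E.

(** Rays form a pi-system generating the Borel sets. Restricting to [[0, b[] discards the mass [G b]
    of [[b, +oo[], where an atom at [b] may sit. *)
Lemma tail_density (A : set R) : measurable A -> A `<=` D ->
  m A = (\int[mu]_(x in A) (g x)%:E)%E.
Proof.
move=> mA AD; have mD : measurable D by exact: measurable_itv.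
have H : mrestr m mD A = density_measureT gD_ge0 mgD A.
  apply: (@measure_unique _ R R (@RGenCInfty.G R)
    (fun n => `[- n%:R, +oo[%classic) _ _ _ _
    (mrestr m mD) (density_measureT gD_ge0 mgD)) => //.
  - exact: RGenCInfty.measurableE.
  - move=> _ _ [x ->] [y ->]; exists (Num.max x y).
    by apply/seteqP; split=> z /=; rewrite !in_itv/= !andbT ge_max => /andP.
  - by move=> n; exists (- n%:R).
  - apply/seteqP; split=> // x _; exists (Num.truncn (- x)).+1 => //=.
    rewrite in_itv/= andbT lerNl ltW// truncnS_gt//.
  - move=> _ [a ->].
    rewrite /density_measureT/= /density_measure /gD -integral_mkcondr /mrestr.
    set a' := Num.max a 0.
    have -> : `[a, +oo[%classic `&` D = `[a', b[%classic.
      apply/seteqP; split=> z /=; rewrite /D/= !in_itv/= !andbT.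
        by move=> [? /andP[? ->]]; rewrite andbT ge_max; apply/andP.
      by rewrite ge_max => /andP[/andP[-> ->] ->].
    have a'0 : 0 <= a' by rewrite le_max lexx orbT.
    have [ab|ba] := ltP a' b; last first.
      by rewrite set_itv_ge ?integral_set0 ?measure0// bnd_simp -leNgt.
    rewrite integral_primitive//.
    have -> : `[a', b[%classic = `[a', +oo[%classic `\` `[b, +oo[%classic :> set R.
      apply/seteqP; split=> z /=; rewrite !in_itv/= !andbT.
        by move=> /andP[-> zb]; split=> //; apply/negP; rewrite -ltNge.
      by move=> [-> /negP]; rewrite -ltNge.
    rewrite measureD//=; last by rewrite mG ?ltry// (ltW ab) a'0.
    rewrite setIidr; last by apply: subset_itv; rewrite ?bnd_simp ?ltW.
    by rewrite !mG ?lexx ?(ltW b0)// ?a'0 ?ltW.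
  - move=> n; rewrite /mrestr; apply: (@le_lt_trans _ _ (m `[0%R, +oo[%classic)).
      apply: le_measure; rewrite ?inE//; first exact: measurableI.
      by move=> z [_]; rewrite /D/= !in_itv/= andbT => /andP[].
    by rewrite mG ?ltry// lexx ltW.
move: H; rewrite /mrestr setIidl// => ->.
by rewrite /density_measureT/= /density_measure /gD -integral_mkcondr setIidl.
Qed.

(** Off the null set [S] carrying the singular part, both [q] and [g] integrate to [m]. Restoring
    [S] does not change the integrals over intervals, and continuity turns their equality into a
    pointwise one. *)
Lemma ac_density_eq (q : R -> R) : is_ac_density m q ->
  {within `[0, b[%classic, continuous q} -> forall x, 0 < x < b -> q x = g x.
Proof.
move=> [mq q0 [nu [[S [mS S0 nuS]] mE]]] cq x xb.
have eqI u v : 0 < u -> u < v -> v < b ->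
    (\int[mu]_(y in `]u, v[) (q y)%:E = \int[mu]_(y in `]u, v[) (g y)%:E)%E.
  move=> u0 uv vb.
  have mI : measurable (`]u, v[%classic : set R) by exact: measurable_itv.
  have mIS : measurable (`]u, v[%classic `\` S : set R) by exact: measurableD.
  have ID : `]u, v[%classic `<=` D.
    move=> y; rewrite /D/= !in_itv/= => /andP[uy yv].
    by rewrite (ltW (lt_trans u0 uy)) (lt_trans yv).
  have := mE _ mIS; rewrite tail_density//; last by move=> y [/ID].
  have -> : nu (`]u, v[%classic `\` S) = 0%E.
    apply/eqP; rewrite eq_le measure_ge0 andbT -nuS le_measure ?inE//.
    exact: measurableC.
  rewrite adde0 => H.
  have e (p : R -> R) : measurable_fun [set: R] p ->
      (forall y, `]u, v[%classic y -> 0 <= p y) ->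
      (\int[mu]_(y in `]u, v[) (p y)%:E = \int[mu]_(y in `]u, v[ `\` S) (p y)%:E)%E.
    move=> mp p0; apply: (@ge0_negligible_integral _ _ _ mu _ S (fun y => (p y)%:E)) => //.
    exact/measurable_EFinP/measurable_funTS.
  by rewrite e// -H -e// => y /ID; rewrite /D/= in_itv/=; exact: g0.
have cqx : {for x, continuous q}.
  have : {within `]0, b[%classic, continuous q}.
    by apply: continuous_subspaceW cq => y /=; rewrite !in_itv/= => /andP[/ltW -> ->].
  by rewrite continuous_open_subspace//; apply; rewrite inE/= in_itv.
apply/eqP; rewrite eq_le; apply/andP; split.
- apply: (@continuous_le_of_integral q g x b) => //; first exact: cg.
  by move=> u v u0 uv vb; rewrite eqI.
- apply: (@continuous_le_of_integral g q x b) => //; first exact: cg.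
  by move=> u v u0 uv vb; rewrite eqI.
Qed.

End Density.

(** * The law of the meander *)

Section SurvivalLaw.
Context {R : realType} {d : measure_display} {Om : measurableType d}
  {P : probability Om R} (lam c : R) (N : R -> {RV P >-> nat}).
Hypotheses (hlam : 0 < lam) (hc : 0 < c).
Hypothesis hN : is_poisson_process lam N.

(** The square of half the usual Bessel argument [(lam / c) sqrt(c^2 t^2 - x^2)]. *)
Definition clifford_arg (x t : R) : R :=
  (lam / (2 * c)) ^+ 2 * ((c * t) ^+ 2 - x ^+ 2).

(* [expR (lam * t)] times the probability that the path stays nonnegative up to
   [t] and ends above [x], given that it starts with velocity [c]. *)
Definition meander_tail (x t : R) : R :=
  clifford 0 (clifford_arg x t)
  + lam / (2 * c) * (c * t - x) * clifford 1 (clifford_arg x t).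

Definition survival_event (B : set R) (t : R) : set Om :=
  [set w | B (c * signed_clock N t w)] `&` survival N t.

Lemma survival_event_past (B : set R) t : 0 <= t -> measurable B ->
  past N t (survival_event B t).
Proof.
move=> t0 mB; apply: (@measurableI _ (past_type N t)); last exact: (survival_past hN).
rewrite -[X in measurable X]setTI.
have : measurable_fun [set: past_type N t] (fun w => c * signed_clock N t w).
  apply: measurable_funM => //; apply: (measurable_signed_clock_past hN).
  by rewrite t0 lexx.
exact.
Qed.

(** Sums the closed forms over the number of jumps: even counts give the series of [clifford 0], odd
    ones that of [clifford 1] with one extra factor [lam / (2 * c) * (c * t - x)]. *)
Lemma survival_event_ray x t : 0 <= t -> 0 <= x <= c * t ->
  expR (lam * t) * fine (P (survival_event `[x, +oo[ t)) = meander_tail x t.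
Proof.
move=> t0 xI; have /andP[x0 xct] := xI.
have -> : survival_event `[x, +oo[ t = \bigcup_n survival_tail c N n x t.
  apply/seteqP; split=> w.
    by move=> [/=]; rewrite in_itv/= andbT => xS Sw; exists (N t w).
  by move=> [n _ [xS Sw Nw]]; split=> //=; rewrite in_itv/= andbT.
have mF n : measurable (survival_tail c N n x t) by exact: (survival_tail_measurable hc hN).
have tF : trivIset setT (fun n => survival_tail c N n x t).
  by apply/trivIsetP => i j _ _ ij; apply/seteqP; split=> // w [[_ _ Ni] [_ _ Nj]];
    move: ij; rewrite -Ni Nj eqxx.
have finU : P (\bigcup_n survival_tail c N n x t) \is a fin_num.
  by rewrite fin_num_measure//; exact: bigcup_measurable.
have H : (\sum_(0 <= i < n) P (survival_tail c N i x t))%E @[n --> \oo] -->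
    (fine (P (\bigcup_n survival_tail c N n x t)))%:E.
  by rewrite fineK//; exact: measure_sigma_additive.
have cu := fine_cvg H.
move: cu {H}; set u := fine (P _) => cu.
pose s n := \sum_(0 <= i < n) tail_prob c N i x t.
have {}cu : s n @[n --> \oo] --> u.
  have -> : s = fine \o (fun n => \sum_(0 <= i < n) P (survival_tail c N i x t))%E; last exact: cu.
  by apply/funext => n; rewrite /s /= -sum_fine// => i _; rewrite fin_num_measure.
(* Only partial sums of even length are used, so that the counts [m.*2] and [m.*2.+1] together
   contribute the [m]-th terms of the two series. *)
have cdouble : m.*2 @[m --> \oo] --> \oo.
  by move=> A [K _ HK]; exists K => // m /= Km; apply: HK => /=;
    rewrite (leq_trans Km)// -addnn leq_addr.
pose z := clifford_arg x t; pose b := lam / (2 * c) * (c * t - x).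
have c1 : expR (lam * t) * s m.*2 @[m --> \oo] --> expR (lam * t) * u.
  by apply: cvgMr; exact: cvg_comp cdouble cu.
have c2 : pseries (clifford_coef 0) z m + b * pseries (clifford_coef 1) z m
    @[m --> \oo] --> meander_tail x t.
  by apply: cvgD; [|apply: cvgMr]; exact: is_cvg_clifford.
suff e : (fun m => expR (lam * t) * s m.*2) =
    (fun m => pseries (clifford_coef 0) z m + b * pseries (clifford_coef 1) z m).
  rewrite e in c1; exact: (cvg_unique _ c1 c2).
apply/funext; elim=> [|m IH].
  by rewrite /s /pseries/= /series/= !big_geq// !mulr0 addr0.
have -> : s m.+1.*2 = s m.*2 + tail_prob c N m.*2 x t + tail_prob c N m.*2.+1 x t.
  by rewrite /s doubleS !big_nat_recr.
rewrite !mulrDr IH !(tail_formula hlam hc hN)// /pseries /series/= !big_nat_recr//=.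
rewrite uphalf_double doubleK /= mulrDr.
have fn0 (n : nat) : (n`!%:R : R) != 0 by rewrite pnatr_eq0 -lt0n fact_gt0.
have ze : z ^+ m = (lam / (2 * c)) ^+ (m + m) * (c * t - x) ^+ m * (c * t + x) ^+ m.
  rewrite /z /clifford_arg subr_sqr; move: (lam / (2 * c)) => e.
  by rewrite exprMn [X in _ * X]exprMn -exprM mul2n addnn mulrA.
rewrite ze /clifford_coef /tail_coef addn0 addn1 addSn !exprS /b !invfM; ring.
Unshelve. all: end_near. Qed.

End SurvivalLaw.

Section TelegraphLaw.
Context {R : realType} {d : measure_display} {Om : measurableType d}
  {P : probability Om R} (lam c : R) (N : R -> {RV P >-> nat}) (V0 : {RV P >-> R}).
Hypotheses (hlam : 0 < lam) (hc : 0 < c).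
Hypothesis hT : is_telegraph_data lam c N V0.

Let hN : is_poisson_process lam N := telegraph_poisson hT.

Lemma telegraphE s w : 0 <= s -> telegraph N V0 s w = V0 w * signed_clock N s w.
Proof.
move=> s0; rewrite /telegraph /telegraph_velocity RintegralZl//.
by apply: integrable_sign_path => // r r' r0 rr'; exact: (poisson_mono hN).
Qed.

Lemma signed_clock_gt0 t w : 0 < t -> exists2 s, 0 < s <= t & 0 < signed_clock N s w.
Proof.
move=> t0; apply: signed_time_gt0 => //.
- by move=> r r' r0 rr'; exact: (poisson_mono hN).
- exact: (poisson_start hN).
- exact: (poisson_rcont hN).
Qed.

Let mV0 (B : set R) : measurable B -> measurable (V0 @^-1` B).
Proof. by move=> mB; rewrite -[X in measurable X]setTI; exact: measurable_funP. Qed.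

(** The law of [V0] fixes its values only almost surely, so all real values are treated. A negative
    one is impossible since [signed_clock] becomes positive before [t]; the result exhibits the
    event as measurable. *)
Lemma stays_nonnegE t : 0 < t -> stays_nonneg (telegraph N V0) t =
  V0 @^-1` [set 0] `|` (V0 @^-1` `]0, +oo[ `&` survival N t).
Proof.
move=> t0; apply/seteqP; split=> w.
  move=> Tw; have [V0w|V0w|V0w] := ltgtP (V0 w) 0.
  - have [s /andP[s0 st] Ss] := signed_clock_gt0 w t0.
    have := Tw s; rewrite (ltW s0) st telegraphE ?(ltW s0)// => /(_ isT).
    by rewrite leNgt nmulr_rlt0// Ss.
  - right; split; first by rewrite /= in_itv/= V0w.
    move=> s sI; have := Tw s sI; rewrite telegraphE; last by case/andP: sI.
    by rewrite pmulr_rge0.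
  - by left.
move=> [/= V0w|[/=]].
  by move=> s /andP[s0 _]; rewrite telegraphE// V0w mul0r.
rewrite in_itv/= andbT => V0w Sw s sI; rewrite telegraphE; last by case/andP: sI.
by rewrite mulr_ge0 ?(ltW V0w)//; exact: Sw.
Qed.

(** On [V0 = c] the event becomes [survival_event], which is independent of [V0]; on [V0 = - c] it
    is empty; the remaining values of [V0] have probability [0]. *)
Lemma stays_nonneg_law (B : set R) t : 0 < t -> measurable B ->
  P ([set w | B (telegraph N V0 t w)] `&` stays_nonneg (telegraph N V0) t) =
  (P (survival_event c N B t) * (2^-1)%:E)%E.
Proof.
move=> t0 mB; have t0' := ltW t0.
set E := _ `&` _; pose A := V0 @^-1` [set c]; pose A' := V0 @^-1` [set - c].
have mS s : 0 <= s -> measurable_fun [set: Om] (signed_clock N s).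
  move=> s0 mT C mC; apply: (past_measurable (t := s)).
  have ss : 0 <= s <= s by rewrite s0 lexx.
  exact: (measurable_signed_clock_past hN ss).
have mE : measurable E.
  apply: measurableI.
    rewrite -[X in measurable X]setTI.
    have : measurable_fun [set: Om] (telegraph N V0 t).
      apply: (eq_measurable_fun (fun w => V0 w * signed_clock N t w)).
        by move=> w _; rewrite telegraphE.
      by apply: measurable_funM => //; exact: mS.
    exact.
  rewrite stays_nonnegE//; apply: measurableU; first exact: mV0.
  apply: measurableI; first exact: mV0.
  by apply: past_measurable; exact: (survival_past hN).
have mA : measurable A by exact: mV0.
have mA' : measurable A' by exact: mV0.
have EA : E `&` A = survival_event c N B t `&` A.
  rewrite /E stays_nonnegE//; apply/seteqP; split=> w.
    move=> [[Bw [/= V0w|[_ Sw]]] Aw]; first by move: hc; rewrite -Aw V0w ltxx.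
    by split=> //; split=> //=; rewrite -Aw -telegraphE.
  move=> [[Bw Sw] Aw]; split=> //; split; first by rewrite /= telegraphE// Aw.
  by right; split=> //=; rewrite in_itv/= andbT Aw.
have EA' : E `&` A' = set0.
  rewrite /E stays_nonnegE//; apply/seteqP; split=> // w [[_ [/= V0w|[/= V0w _]]] A'w].
    by move: hc; rewrite -oppr_lt0 -A'w V0w ltxx.
  by move: V0w; rewrite in_itv/= andbT A'w oppr_gt0 ltNge ltW.
have AA' : A `&` A' = set0.
  apply/seteqP; split=> // w [/= Aw A'w].
  have : c = - c := etrans (esym Aw) A'w.
  by move: hc; lra.
have PAA' : P (~` (A `|` A')) = 0%E.
  rewrite probability_setC; last exact: measurableU.
  have -> : P (A `|` A') = ((2^-1)%:E + (2^-1)%:E)%E.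
    rewrite measureU//; congr (_ + _)%E; first exact: (telegraph_V0_pos hT).
    exact: (telegraph_V0_neg hT).
  rewrite -EFinD (_ : 2^-1 + 2^-1 = 1); last by lra.
  by rewrite subrr.
have EAA' : P (E `\` A) = 0%E.
  apply/eqP; rewrite eq_le measure_ge0 andbT -PAA' le_measure ?inE//.
  - exact: measurableD.
  - by apply: measurableC; exact: measurableU.
  - move=> w [Ew Aw] [//|A'w].
    by have : (E `&` A') w by []; rewrite EA'.
have -> : P E = (P (E `\` A) + P (E `&` A))%E by exact: measureDI.
rewrite EAA' add0e EA /A (telegraph_V0_indep hT)//.
  by rewrite (telegraph_V0_pos hT).
by apply: (past_sigma_process (t := t)); exact: (survival_event_past c hN).
Qed.

End TelegraphLaw.

(** * The differential equation *)

Section SecondDerivatives.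
Context {R : realType}.

Lemma derive12_on_open (U : set R) (f phi phi1 : R -> R) (x a : R) :
  open U -> U x -> (forall y, U y -> f y = phi y) ->
  (forall y : R, U y -> is_derive y 1 phi (phi1 y)) -> is_derive x 1 phi1 a ->
  [/\ derivable f x 1, derive1 f x = phi1 x,
      derivable (derive1 f) x 1 & derive1n 2 f x = a].
Proof.
move=> oU Ux fphi dphi dphi1.
have near_U y : U y -> \forall z \near y, U z by move=> Uy; exact: open_nbhs_nbhs.
have f1 y : U y -> derivable f y 1 /\ derive1 f y = phi1 y.
  move=> Uy; have e : {near y, phi =1 f}.
    by near=> z; rewrite fphi//; near: z; exact: near_U.
  have [dp <-] := dphi y Uy; split; first exact: near_eq_derivable e dp.
  by rewrite derive1E; apply/esym/near_eq_derive.
have e1 : {near x, phi1 =1 derive1 f}.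
  by near=> z; rewrite (f1 z _).2//; near: z; exact: near_U.
have [dp1 <-] := dphi1; split.
- exact: (f1 x Ux).1.
- exact: (f1 x Ux).2.
- exact: near_eq_derivable e1 dp1.
- by rewrite derive1nS /= derive1E; apply/esym/near_eq_derive.
Unshelve. all: end_near. Qed.

Lemma derive12_quotient (U : set R) (f u v u1 v1 : R -> R) (x u2 v2 : R) :
  open U -> U x -> (forall y, U y -> f y = u y / v y) ->
  (forall y, U y -> v y != 0) ->
  (forall y : R, is_derive y 1 u (u1 y)) -> (forall y : R, is_derive y 1 v (v1 y)) ->
  is_derive x 1 u1 u2 -> is_derive x 1 v1 v2 ->
  [/\ derivable f x 1, derive1 f x = u1 x / v x - u x * v1 x / v x ^+ 2,
      derivable (derive1 f) x 1 &
      derive1n 2 f x = u2 / v x - 2 * (u1 x * v1 x / v x ^+ 2)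
        - u x * v2 / v x ^+ 2 + 2 * (u x * v1 x ^+ 2 / v x ^+ 3)].
Proof.
move=> oU Ux fuv v0 du dv du1 dv1; have v0x := v0 x Ux.
apply: (@derive12_on_open U f (fun y => u y / v y)
  (fun y => u1 y / v y - u y * v1 y / v y ^+ 2)) => //.
  move=> y Uy; have v0y := v0 y Uy.
  apply: is_derive_eq (is_derive_mulf (du y) (is_derive_invf v0y (dv y))) _.
  by field.
have dv2 : is_derive x 1 (fun y => v y ^+ 2) (2 * v x * v1 x).
  apply: is_derive_eq (is_derive_compf (is_derive_exprf 1 (v x)) (dv x)) _.
  by rewrite expr1.
have vx2 : v x ^+ 2 != 0 by rewrite expf_neq0.
apply: is_derive_eq (is_derive_addf (is_derive_mulf du1 (is_derive_invf v0x (dv x)))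
  (is_derive_oppf (is_derive_mulf (is_derive_mulf (du x) dv1) (is_derive_invf (f := fun y => v y ^+ 2) vx2 dv2)))) _.
by field.
Qed.

End SecondDerivatives.

Section MeanderDensity.
Context {R : realType}.
Variables (lam c : R).
Hypotheses (hlam : 0 < lam) (hc : 0 < c).

Let beta := lam / (2 * c).
Local Notation arg := (clifford_arg lam c).
Local Notation C j x t := (clifford j (clifford_arg lam c x t)).

Lemma is_derive_clifford_x j (x t : R) :
  is_derive x 1 (fun y => C j y t) (- (2 * beta ^+ 2 * x) * C j.+1 x t).
Proof.
have da : is_derive x 1 (fun y => arg y t) (- (2 * beta ^+ 2 * x)).
  apply: is_derive_eq (is_derive_scalef (beta ^+ 2) (is_derive_addf
    (is_derive_cstf x ((c * t) ^+ 2)) (is_derive_oppf (is_derive_exprf 1 x)))) _.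
  by rewrite expr1; ring.
by rewrite mulrC; exact: is_derive_compf (is_derive_clifford j _) da.
Qed.

Lemma is_derive_clifford_t j (x t : R) :
  is_derive t 1 (fun s => C j x s) (2 * beta ^+ 2 * c ^+ 2 * t * C j.+1 x t).
Proof.
have da : is_derive t 1 (fun s => arg x s) (2 * beta ^+ 2 * c ^+ 2 * t).
  have dc : is_derive t 1 (fun s => c * s) c.
    by apply: is_derive_eq (is_derive_scalef c (is_derive_idf t)) _; rewrite mulr1.
  apply: is_derive_eq (is_derive_scalef (beta ^+ 2) (is_derive_addf
    (is_derive_compf (is_derive_exprf 1 (c * t)) dc) (is_derive_cstf t (- x ^+ 2)))) _.
  by rewrite expr1; ring.
by rewrite mulrC; exact: is_derive_compf (is_derive_clifford j _) da.
Qed.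

(** The unnormalized density, minus the [x]-derivative of [meander_tail]. The derivatives that
    follow are kept as polynomial combinations of Clifford functions, so that the later identities
    reduce to [ring]. *)
Definition mdens (x t : R) : R :=
  (beta + 2 * beta ^+ 2 * x) * C 1 x t + 2 * beta ^+ 3 * (x * (c * t - x)) * C 2 x t.

Definition mdens_x (x t : R) : R :=
  2 * beta ^+ 2 * C 1 x t
  + (2 * beta ^+ 3 * c * t - 6 * beta ^+ 3 * x - 4 * beta ^+ 4 * x ^+ 2) * C 2 x t
  - 4 * beta ^+ 5 * (x ^+ 2 * (c * t - x)) * C 3 x t.

Definition mdens_t (x t : R) : R :=
  ((beta + 2 * beta ^+ 2 * x) * (2 * beta ^+ 2 * c ^+ 2 * t) + 2 * beta ^+ 3 * x * c)
    * C 2 x t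
  + 4 * beta ^+ 5 * c ^+ 2 * x * (t * (c * t - x)) * C 3 x t.

Definition mdens_xx (x t : R) : R :=
  - (6 * beta ^+ 3 + 12 * beta ^+ 4 * x) * C 2 x t
  + ((2 * beta ^+ 3 * c * t - 6 * beta ^+ 3 * x - 4 * beta ^+ 4 * x ^+ 2)
     * (- (2 * beta ^+ 2 * x)) - 4 * beta ^+ 5 * (2 * x * c * t - 3 * x ^+ 2)) * C 3 x t
  + 8 * beta ^+ 7 * x ^+ 3 * (c * t - x) * C 4 x t.

Definition mdens_tt (x t : R) : R :=
  (beta + 2 * beta ^+ 2 * x) * (2 * beta ^+ 2 * c ^+ 2) * C 2 x t
  + (((beta + 2 * beta ^+ 2 * x) * (2 * beta ^+ 2 * c ^+ 2 * t) + 2 * beta ^+ 3 * x * c)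
       * (2 * beta ^+ 2 * c ^+ 2 * t)
     + 4 * beta ^+ 5 * c ^+ 2 * x * (2 * c * t - x)) * C 3 x t
  + 8 * beta ^+ 7 * c ^+ 4 * x * (t ^+ 2 * (c * t - x)) * C 4 x t.

Lemma is_derive_meander_tail_x (x t : R) :
  is_derive x 1 (fun y => meander_tail lam c y t) (- mdens x t).
Proof.
have dl : is_derive x 1 (fun y => beta * (c * t - y)) (- beta).
  apply: is_derive_eq (is_derive_scalef beta (is_derive_addf
    (is_derive_cstf x (c * t)) (is_derive_oppf (is_derive_idf x)))) _.
  by ring.
apply: is_derive_eq (is_derive_addf (is_derive_clifford_x 0 x t)
  (is_derive_mulf dl (is_derive_clifford_x 1 x t))) _.
by rewrite /mdens; ring.
Qed.

Lemma is_derive_mdens_x (x t : R) : is_derive x 1 (fun y => mdens y t) (mdens_x x t).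
Proof.
have d1 : is_derive x 1 (fun y => beta + 2 * beta ^+ 2 * y) (2 * beta ^+ 2).
  apply: is_derive_eq (is_derive_addf (is_derive_cstf x beta)
    (is_derive_scalef (2 * beta ^+ 2) (is_derive_idf x))) _.
  by ring.
have d2 : is_derive x 1 (fun y => 2 * beta ^+ 3 * (y * (c * t - y)))
    (2 * beta ^+ 3 * (c * t - 2 * x)).
  apply: is_derive_eq (is_derive_scalef (2 * beta ^+ 3) (is_derive_mulf (is_derive_idf x)
    (is_derive_addf (is_derive_cstf x (c * t)) (is_derive_oppf (is_derive_idf x))))) _.
  by ring.
apply: is_derive_eq (is_derive_addf (is_derive_mulf d1 (is_derive_clifford_x 1 x t))
  (is_derive_mulf d2 (is_derive_clifford_x 2 x t))) _.
by rewrite /mdens_x; ring.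
Qed.

Lemma is_derive_mdens_xx (x t : R) : is_derive x 1 (fun y => mdens_x y t) (mdens_xx x t).
Proof.
have dct : is_derive x 1 (fun y => c * t - y) (-1).
  apply: is_derive_eq (is_derive_addf (is_derive_cstf x (c * t))
    (is_derive_oppf (is_derive_idf x))) _.
  by ring.
have d2 : is_derive x 1
    (fun y => 2 * beta ^+ 3 * c * t - 6 * beta ^+ 3 * y - 4 * beta ^+ 4 * y ^+ 2)
    (- (6 * beta ^+ 3) - 8 * beta ^+ 4 * x).
  apply: is_derive_eq (is_derive_addf (is_derive_addf
    (is_derive_cstf x (2 * beta ^+ 3 * c * t))
    (is_derive_oppf (is_derive_scalef (6 * beta ^+ 3) (is_derive_idf x))))
    (is_derive_oppf (is_derive_scalef (4 * beta ^+ 4) (is_derive_exprf 1 x)))) _.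
  by rewrite expr1; ring.
have d3 := is_derive_scalef (4 * beta ^+ 5) (is_derive_mulf (is_derive_exprf 1 x) dct).
apply: is_derive_eq (is_derive_addf (is_derive_addf
  (is_derive_scalef (2 * beta ^+ 2) (is_derive_clifford_x 1 x t))
  (is_derive_mulf d2 (is_derive_clifford_x 2 x t)))
  (is_derive_oppf (is_derive_mulf d3 (is_derive_clifford_x 3 x t)))) _.
by rewrite /mdens_xx expr1; ring.
Qed.

Lemma is_derive_mdens_t (x t : R) : is_derive t 1 (fun s => mdens x s) (mdens_t x t).
Proof.
have dct : is_derive t 1 (fun s => c * s - x) c.
  apply: is_derive_eq (is_derive_addf (is_derive_scalef c (is_derive_idf t))
    (is_derive_cstf t (- x))) _.
  by ring.
have d2 := is_derive_scalef (2 * beta ^+ 3) (is_derive_scalef x dct).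
apply: is_derive_eq (is_derive_addf
  (is_derive_scalef (beta + 2 * beta ^+ 2 * x) (is_derive_clifford_t 1 x t))
  (is_derive_mulf d2 (is_derive_clifford_t 2 x t))) _.
by rewrite /mdens_t; ring.
Qed.

Lemma is_derive_mdens_tt (x t : R) : is_derive t 1 (fun s => mdens_t x s) (mdens_tt x t).
Proof.
have dct : is_derive t 1 (fun s => c * s - x) c.
  apply: is_derive_eq (is_derive_addf (is_derive_scalef c (is_derive_idf t))
    (is_derive_cstf t (- x))) _.
  by ring.
have d2 := is_derive_addf (is_derive_scalef (beta + 2 * beta ^+ 2 * x)
  (is_derive_scalef (2 * beta ^+ 2 * c ^+ 2) (is_derive_idf t)))
  (is_derive_cstf t (2 * beta ^+ 3 * x * c)).
have d3 := is_derive_scalef (4 * beta ^+ 5 * c ^+ 2 * x) (is_derive_mulf (is_derive_idf t) dct).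
apply: is_derive_eq (is_derive_addf
  (is_derive_mulf d2 (is_derive_clifford_t 2 x t))
  (is_derive_mulf d3 (is_derive_clifford_t 3 x t))) _.
by rewrite /mdens_tt; ring.
Qed.

(** The recurrences eliminate the Clifford functions of index [1] and [2] in favour of those of
    index [3] and [4]; what remains is a polynomial identity. Here [4 * beta ^+ 2 * c ^+ 2] is
    [lam ^+ 2]. *)
Lemma mdens_klein_gordon (x t : R) :
  mdens_tt x t - c ^+ 2 * mdens_xx x t = 4 * beta ^+ 2 * c ^+ 2 * mdens x t.
Proof.
rewrite /mdens_tt /mdens_xx /mdens (clifford_rec 1) (clifford_rec 2) /clifford_arg -/beta.
ring.
Qed.

(* The normalizing constant, up to the factor [expR (- lam * t)]. *)
Definition mnorm (t : R) : R := meander_tail lam c 0 t.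

(** In this form the logarithmic derivative of [mnorm] reads [lam - a(t) / t], with [a] the Bessel
    ratio; this is how [a] enters the equation. *)
Definition mnorm_t (t : R) : R := 2 * beta * c * mnorm t - beta * c * C 1 0 t.

Definition mnorm_tt (t : R) : R :=
  2 * beta * c * mnorm_t t - 2 * beta ^+ 3 * c ^+ 3 * t * C 2 0 t.

Lemma is_derive_mnorm (t : R) : is_derive t 1 mnorm (mnorm_t t).
Proof.
have dl : is_derive t 1 (fun s => beta * (c * s - 0)) (beta * c).
  apply: is_derive_eq (is_derive_scalef beta (is_derive_addf
    (is_derive_scalef c (is_derive_idf t)) (is_derive_cstf t (- 0)))) _.
  by ring.
apply: is_derive_eq (is_derive_addf (is_derive_clifford_t 0 0 t)
  (is_derive_mulf dl (is_derive_clifford_t 1 0 t))) _.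
rewrite /mnorm_t /mnorm /meander_tail (clifford_rec 0) /clifford_arg -/beta; ring.
Qed.

Lemma is_derive_mnorm_t (t : R) : is_derive t 1 mnorm_t (mnorm_tt t).
Proof.
apply: is_derive_eq (is_derive_addf (is_derive_scalef (2 * beta * c) (is_derive_mnorm t))
  (is_derive_oppf (is_derive_scalef (beta * c) (is_derive_clifford_t 1 0 t)))) _.
rewrite /mnorm_tt; ring.
Qed.

Lemma clifford_arg_ge0 x t : 0 <= x <= c * t -> 0 <= arg x t.
Proof.
move=> /andP[x0 xct]; rewrite mulr_ge0 ?exprn_ge0 ?divr_ge0 ?mulr_ge0 ?(ltW hlam) ?(ltW hc)//.
by rewrite subr_ge0 lerXn2r// nnegrE// (le_trans x0).
Qed.

Let beta_gt0 : 0 < beta.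
Proof. by rewrite divr_gt0// mulr_gt0. Qed.

Lemma mdens_ge0 x t : 0 <= x <= c * t -> 0 <= mdens x t.
Proof.
move=> xI; have z0 := clifford_arg_ge0 xI; move: (xI) => /andP[x0 xct].
have b0 := ltW beta_gt0.
have C0 j := ltW (clifford_gt0 j z0).
have e0 n : 0 <= beta ^+ n by exact: exprn_ge0.
apply: addr_ge0; apply: mulr_ge0 => //.
  by apply: addr_ge0 => //; apply: mulr_ge0 => //; apply: mulr_ge0.
by apply: mulr_ge0; apply: mulr_ge0 => //; rewrite subr_ge0.
Qed.

Lemma mnorm_gt0 t : 0 < t -> 0 < mnorm t.
Proof.
move=> t0; have ct0 : 0 <= c * t by rewrite mulr_ge0 ?ltW.
have z0 : 0 <= arg 0 t by apply: clifford_arg_ge0; rewrite lexx.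
rewrite /mnorm /meander_tail ltr_pwDl ?clifford_gt0// subr0 -/beta.
by apply: mulr_ge0; [apply: mulr_ge0 => //; exact: ltW|exact: ltW (clifford_gt0 _ z0)].
Qed.

Lemma bessel_ratioE t : 0 < t ->
  bessel_ratio lam t = beta * c * t * C 1 0 t / mnorm t.
Proof.
move=> t0; have lt0 : 0 < lam * t by rewrite mulr_gt0.
have b0 : besselI 0 (lam * t) = clifford 0 ((lam * t / 2) ^+ 2).
  by have := besselI_clifford 0 lt0; rewrite expr0 mul1r.
have b1 : besselI 1 (lam * t) = lam * t / 2 * clifford 1 ((lam * t / 2) ^+ 2).
  by have := besselI_clifford 1 lt0; rewrite expr1.
have e : lam * t / 2 = beta * c * t by rewrite /beta; field; rewrite gt_eqF.
rewrite /bessel_ratio b0 b1 e /mnorm /meander_tail -/beta.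
rewrite (_ : (beta * c * t) ^+ 2 = arg 0 t); last by rewrite /clifford_arg -/beta; ring.
by rewrite subr0 !mulrA.
Qed.

(** Write [n] for [mnorm]. Substituting [g = n u] in the Klein-Gordon equation and dividing by [n]
    gives [u_tt - c^2 u_xx + 2 (n'/n) u_t = (lam^2 - n''/n) u], where [n'/n = lam - a/t] and
    [n''/n = lam^2 - lam/t + 2 a/t^2]. *)
Lemma meander_density_pde (q : R -> R -> R) :
  (forall x t : R, 0 < t -> 0 < x < c * t -> q x t = mdens x t / mnorm t) ->
  forall x t : R, 0 < t -> 0 < x < c * t ->
  [/\ derivable (q x) t 1,
        derivable (derive1 (q x)) t 1,
        derivable (fun y => q y t) x 1,
        derivable (derive1 (fun y => q y t)) x 1 &
        derive1n 2 (q x) t - c ^+ 2 * derive1n 2 (fun y => q y t) x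
          + 2 * lam * derive1 (q x) t
          - 2 * bessel_ratio lam t / t * derive1 (q x) t
        = (lam / t - 2 * bessel_ratio lam t / t ^+ 2) * q x t].
Proof.
move=> qE x t t0 xct; have /andP[x0 xt] := xct.
have nt0 := mnorm_gt0 t0; have nn0 : mnorm t != 0 by rewrite gt_eqF.
have xc0 : 0 < x / c by rewrite divr_gt0.
have oU : open (`]x / c, +oo[%classic : set R) by exact: interval_open.
have Ut : (`]x / c, +oo[%classic : set R) t.
  by rewrite /= in_itv/= andbT ltr_pdivrMr// mulrC.
have Upos (s : R) : (`]x / c, +oo[%classic : set R) s -> 0 < s.
  by rewrite /= in_itv/= andbT; exact: lt_trans.
have qU (s : R) : (`]x / c, +oo[%classic : set R) s -> q x s = mdens x s / mnorm s.
  move=> Us; apply: qE; first exact: Upos.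
  by move: Us; rewrite /= in_itv/= andbT x0 ltr_pdivrMr// mulrC.
have nU (s : R) : (`]x / c, +oo[%classic : set R) s -> mnorm s != 0.
  by move=> /Upos s0; rewrite gt_eqF// mnorm_gt0.
have [dt1 et1 dt2 et2] := derive12_quotient oU Ut qU nU
  (is_derive_mdens_t x) is_derive_mnorm (is_derive_mdens_tt x t) (is_derive_mnorm_t t).
have oI : open (`]0, c * t[%classic : set R) by exact: interval_open.
have Ix : (`]0, c * t[%classic : set R) x by rewrite /= in_itv/=.
have qI (y : R) : (`]0, c * t[%classic : set R) y -> q y t = (mnorm t)^-1 * mdens y t.
  by rewrite /= in_itv/= => yI; rewrite mulrC; exact: qE.
have [dx1 _ dx2 ex2] := derive12_on_open oI Ix qI
  (fun y _ => is_derive_scalef (mnorm t)^-1 (is_derive_mdens_x y t))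
  (is_derive_scalef (mnorm t)^-1 (is_derive_mdens_xx x t)).
split=> //; rewrite et1 et2 ex2 (qE x t t0 xct) (bessel_ratioE t0).
have -> : mdens_tt x t = c ^+ 2 * mdens_xx x t + 4 * beta ^+ 2 * c ^+ 2 * mdens x t.
  by rewrite -mdens_klein_gordon; ring.
have lamE : lam = 2 * beta * c by rewrite /beta; field; rewrite gt_eqF.
(* After division by [t * mnorm t] this is the value of [n''/n]; the recurrence at index [0] trades
   [clifford 2] for [clifford 0] and [clifford 1]. *)
have ntt : t * mnorm_tt t = (4 * beta ^+ 2 * c ^+ 2 * t - 2 * beta * c) * mnorm t
    + 2 * beta * c * C 1 0 t.
  rewrite /mnorm_tt /mnorm_t /mnorm /meander_tail -/beta (clifford_rec 0) /clifford_arg -/beta.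
  ring.
have {}ntt : mnorm_tt t = ((4 * beta ^+ 2 * c ^+ 2 * t - 2 * beta * c) * mnorm t
    + 2 * beta * c * C 1 0 t) / t.
  by rewrite -ntt mulrC mulKf// gt_eqF.
rewrite ntt /mnorm_t lamE; field.
by rewrite nn0 gt_eqF.
Qed.

End MeanderDensity.

Section MeanderLaw.
Context {R : realType} {d : measure_display} {Om : measurableType d}
  {P : probability Om R} (lam c : R) (N : R -> {RV P >-> nat}) (V0 : {RV P >-> R}).
Hypotheses (hlam : 0 < lam) (hc : 0 < c).
Hypothesis hT : is_telegraph_data lam c N V0.
Context {d' : measure_display} {Om' : measurableType d'} {Q : probability Om' R}
  (Tp : R -> {RV Q >-> R}) (t : R).
Hypothesis t0 : 0 < t.
Hypothesis hTp : is_telegraph_meander N V0 t Tp.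

(** The factors [2^-1] from the initial velocity and [expR (- (lam * t))] cancel in the conditional
    quotient. Under survival the full event is the ray at level [0], which identifies the
    denominator with [mnorm]. *)
Lemma meander_law_ray (a : R) : 0 <= a <= c * t ->
  distribution Q (Tp t) `[a, +oo[%classic = (meander_tail lam c a t / mnorm lam c t)%:E.
Proof.
move=> aI; have t0' := ltW t0; have hN := telegraph_poisson hT.
have ct0 : 0 <= c * t by rewrite mulr_ge0// ltW.
have mI (x : R) : measurable (`[x, +oo[%classic : set R) by exact: measurable_itv.
have path : path_events t [set f : R -> R | `[a, +oo[%classic (f t)].
  by apply: sub_sigma_algebra; exists t, `[a, +oo[%classic; split => //; rewrite t0' lexx.
have -> : distribution Q (Tp t) `[a, +oo[%classic =
    Q [set w | [set f : R -> R | `[a, +oo[%classic (f t)] (fun s => Tp s w)] by [].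
rewrite (meander_law hTp path) /cond_prob; congr EFin.
have E := stays_nonneg_law hc hT t0 (mI a).
have E0 := stays_nonneg_law hc hT t0 (@measurableT _ R).
rewrite (_ : [set w | _] `&` _ =
  [set w | `[a, +oo[%classic (telegraph N V0 t w)] `&` stays_nonneg (telegraph N V0) t)// E.
rewrite -[X in _ / fine (P X)]setTI E0.
have finE (B : set R) : measurable B -> P (survival_event c N B t) \is a fin_num.
  move=> mB; rewrite fin_num_measure//; apply: past_measurable.
  exact: (survival_event_past c hN t0' mB).
rewrite !fineM ?finE//=.
have -> : survival_event c N setT t = survival_event c N `[0, +oo[%classic t.
  apply/seteqP; split=> w [] _ Sw; split=> //=.
  by rewrite in_itv/= andbT mulr_ge0 ?(ltW hc)//; apply: Sw; rewrite t0' lexx.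
have e1 := survival_event_ray hlam hc hN t0' aI.
have I0 : 0 <= (0 : R) <= c * t by rewrite lexx.
have e2 := survival_event_ray hlam hc hN t0' I0.
have nt0 := mnorm_gt0 hlam hc t0.
rewrite -e1 /mnorm -e2 in nt0 *.
set A := fine _; set B := fine _ in nt0 *.
have ex0 : expR (lam * t) != 0 by rewrite gt_eqF ?expR_gt0.
have B0 : B != 0.
  by apply: contraTneq nt0 => ->; rewrite mulr0 ltxx.
by field; rewrite ex0 B0.
Qed.

Lemma meander_density (q : R -> R) :
  is_ac_density (distribution Q (Tp t)) q ->
  {within `[0, c * t[%classic, continuous q} ->
  forall x, 0 < x < c * t -> q x = mdens lam c x t / mnorm lam c t.
Proof.
move=> hq cq; have nt0 := mnorm_gt0 hlam hc t0.
refine (@ac_density_eq R (c * t) (fun x => mdens lam c x t / mnorm lam c t)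
  (fun a => meander_tail lam c a t / mnorm lam c t) _ _ _ _ _ _ q hq cq).
- by rewrite mulr_gt0.
- move=> x; have [dx _] := is_derive_mdens_x lam c x t.
  have cx := differentiable_continuous (proj1 (derivable1_diffP _ _) dx).
  exact: cvgM cx (cvg_cst _).
- move=> y /andP[y0 yct]; rewrite divr_ge0 ?(ltW nt0)//.
  by apply: mdens_ge0 => //; rewrite y0 ltW.
- move=> y; rewrite mulrC -mulrN.
  under [X in is_derive _ _ X]eq_fun do rewrite mulrC.
  exact: is_derive_scalef (is_derive_meander_tail_x lam c y t).
- by move=> a aI; exact: meander_law_ray.
Qed.

End MeanderLaw.

Unset Implicit Arguments.

Theorem theorem3p2 (R : realType) (lam c : R) (hlam : 0 < lam) (hc : 0 < c)
    (d : measure_display) (Om : measurableType d) (P : probability Om R)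
    (N : R -> {RV P >-> nat}) (V0 : {RV P >-> R})
    (hT : is_telegraph_data lam c N V0)
    (d' : R -> measure_display) (Om' : forall t : R, measurableType (d' t))
    (Q : forall t : R, probability (Om' t) R)
    (Tp : forall t : R, R -> {RV (Q t) >-> R})
    (hTp : forall t : R, 0 < t -> is_telegraph_meander N V0 t (Tp t))
    (q : R -> R -> R)
    (hq : forall t : R, 0 < t ->
       is_ac_density (distribution (Q t) (Tp t t)) (fun x => q x t) /\
       {within `[0, c * t[%classic, continuous (fun x => q x t)}) :
  forall x t : R, 0 < t -> 0 < x < c * t ->
    let a := bessel_ratio lam in
    [/\ derivable (q x) t 1,
        derivable (derive1 (q x)) t 1,
        derivable (fun y => q y t) x 1,
        derivable (derive1 (fun y => q y t)) x 1 &
        derive1n 2 (q x) t - c ^+ 2 * derive1n 2 (fun y => q y t) x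
          + 2 * lam * derive1 (q x) t
          - 2 * a t / t * derive1 (q x) t
        = (lam / t - 2 * a t / t ^+ 2) * q x t].
Proof.
move=> x t t0 xct a; apply: (meander_density_pde hlam hc) => // y s s0 ys.
have [dens cont] := hq s s0.
exact: (meander_density hlam hc hT s0 (hTp s s0) dens cont).
Qed.
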